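(* Let $W$ be a real random variable with $W\ge 0$, $\mathbb{E}W=1$, $\mathbb{E}[W\log_2^+W]<\infty$ and $\mathbb{E}[W\log_2 W]<1$. Let $\widetilde\mu^{\mathbb{T}}$ be the canonical scalar dyadic cascade on $\mathbb{T}=\mathbb{R}/\mathbb{Z}$ generated by $W$, and let $\Gamma:\mathbb{T}\to\mathbb{R}^2$ be a fixed (deterministic) nondegenerate $C^2$ Jordan curve. Then, almost surely on the event $\{\widetilde\mu^{\mathbb{T}}(\mathbb{T})>0\}$, $$\widehat{\Gamma_\#\widetilde\mu^{\mathbb{T}}}(\xi)\longrightarrow 0\qquad(|\xi|\to\infty,\ \xi\in\mathbb{R}^2).$$
   Context: Conventions: $\log_2^+x=\max\{\log_2 x,0\}$ and $0\log_2 0=0$. Circle cascade. For a word $u=(u_1,\dots,u_n)\in\{0,1\}^n$ write $|u|=n$, $u|k=(u_1,\dots,u_k)$, $a_u=\sum_{j=1}^nu_j2^{-j}$, and let $I_u^{\mathbb{T}}=\{t+\mathbb{Z}:t\in[a_u,a_u+2^{-n})\}\subset\mathbb{T}$. Attach i.i.d. copies $W_u^{\mathbb{T}}$ of $W$ to all nonempty finite words. Set $A_\varnothing^{\mathbb{T}}=1$ and $A_u^{\mathbb{T}}=2^{-n}\prod_{k=1}^nW_{u|k}^{\mathbb{T}}$ for $|u|=n$, and let $\widetilde\mu_n^{\mathbb{T}}$ be the measure on $\mathbb{T}$ with density $\sum_{|u|=n}2^nA_u^{\mathbb{T}}\mathbf 1_{I_u^{\mathbb{T}}}$ with respect to normalized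 Haar measure. Under the stated assumptions on $W$, almost surely $\widetilde\mu_n^{\mathbb{T}}$ converges weakly to a finite Borel measure $\widetilde\mu^{\mathbb{T}}$, the canonical scalar dyadic cascade on $\mathbb{T}$ generated by $W$. A fixed nondegenerate $C^2$ Jordan curve is a $C^2$ embedding $\Gamma:\mathbb{T}\to\mathbb{R}^2$ such that $\inf_{t\in\mathbb{T}}|\Gamma'(t)|>0$ and $\inf_{t\in\mathbb{T}}|\det(\Gamma'(t),\Gamma''(t))|>0$, where derivatives are those of the associated $1$-periodic $C^2$ lift to $\mathbb{R}$. The curve is chosen before the cascade is sampled; the exceptional null set may depend on $\Gamma$. Fourier transform: for a finite Borel measure $\nu$ on $\mathbb{R}^2$, $\widehat\nu(\xi)=\int e^{-2\pi i\xi\cdot x}\,d\nu(x)$; $\Gamma_\#$ denotes pushforward. *)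

(* Defs.v *)
From HB Require Import structures.
From mathcomp Require Import all_boot all_order all_algebra.
From mathcomp Require Import generic_quotient ring_quotient.
From mathcomp Require Import all_classical all_reals all_analysis.
From mathcomp Require Import measurable_realfun.
From mathcomp Require Import complex.

Set Implicit Arguments.
Unset Strict Implicit.
Unset Printing Implicit Defensive.

Import Order.TTheory GRing.Theory Num.Theory.
Import numFieldNormedType.Exports.

Local Open Scope classical_set_scope.
Local Open Scope ring_scope.

Definition integers (R : realType) : {pred R} := fun x => x \is a Num.int.
Arguments integers : clear implicits.

Lemma integers_zmod_closed (R : realType) : zmod_closed (integers R).
Proof.
split=> [|x y]; rewrite !unfold_in; first exact: int_num0.
move=> xZ yZ; exact: (rpredB xZ yZ).
Qed.

HB.instance Definition _ (R : realType) :=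
  GRing.isZmodClosed.Build R (integers R) (integers_zmod_closed R).

(* The circle R/Z: the quotient group of R by its subgroup of integers, with  *)
(* the quotient topology and the Borel sigma-algebra.                         *)
Definition circle (R : realType) : Type :=
  quotient_topology {ideal_quot (integers R)}.

HB.instance Definition _ (R : realType) := PointedTopological.on (circle R).
HB.instance Definition _ (R : realType) := Quotient.on (circle R).
HB.instance Definition _ (R : realType) :=
  Measurable.copy (circle R) (g_sigma_algebraType (@open (circle R))).

Definition circle_pi {R : realType} (t : R) : circle R := (\pi_(circle R) t)%qT.

Lemma circle_piP (R : realType) (s t : R) :
  circle_pi s = circle_pi t <-> s - t \is a Num.int.
Proof.
have -> : (s - t \is a Num.int) = (s - t \in integers R) by rewrite unfold_in.
rewrite Quotient.idealrBE; by split=> [st|/eqP//]; apply/eqP.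
Qed.

Lemma continuous_circle_pi (R : realType) : continuous (@circle_pi R).
Proof. exact: pi_continuous. Qed.

Lemma measurable_circle_pi (R : realType) :
  measurable_fun [set: R] (@circle_pi R).
Proof.
apply: (@measurability _ _ _ _ _ _ (@open (circle R))) => //.
move=> _ [A oA <-]; rewrite setTI; apply: open_measurable.
by move/continuousP: (@continuous_circle_pi R); apply.
Qed.

(* Normalized Haar measure, i.e. the image of Lebesgue measure on [0, 1).     *)
Section haar.
Context (R : realType).

Definition haar : set (circle R) -> \bar R :=
  pushforward (mrestr (@lebesgue_measure R) (measurable_itv `[0, 1[))
    (@circle_pi R).

Let mrestr01 := mrestr (@lebesgue_measure R) (measurable_itv `[0, 1[).

Let haar0 : haar set0 = 0%E.
Proof. by rewrite /haar /pushforward preimage_set0 measure0. Qed.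

Let haar_ge0 A : (0 <= haar A)%E.
Proof. exact: (measure_ge0 mrestr01). Qed.

Let haar_sigma_additive : semi_sigma_additive haar.
Proof.
move=> F mF tF mUF; rewrite /haar /pushforward preimage_bigcup.
have mpi A : measurable A -> measurable (@circle_pi R @^-1` A).
  by move=> mA; rewrite -[X in measurable X]setTI; exact: measurable_circle_pi.
apply: (@measure_semi_sigma_additive _ _ _ mrestr01) => [n| |].
- exact: mpi.
- apply/trivIsetP => /= i j _ _ ij; rewrite -preimage_setI.
  by move/trivIsetP : tF => /(_ _ _ _ _ ij) ->//; rewrite preimage_set0.
- by rewrite -preimage_bigcup; exact: mpi.
Qed.

HB.instance Definition _ := isMeasure.Build _ _ _ haar
  haar0 haar_ge0 haar_sigma_additive.

Let haar_setT : haar setT = 1%:E.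
Proof.
rewrite /haar /pushforward /= preimage_setT /mrestr setTI.
by rewrite lebesgue_measure_itv/= lte_fin ltr01 oppr0 adde0.
Qed.

HB.instance Definition _ := Measure_isProbability.Build _ _ _ haar haar_setT.

End haar.
Arguments haar : clear implicits.

(* As ln 0 = 0 here, x * log2 x vanishes at x = 0.                            *)
Definition log2 {R : realType} (x : R) : R := ln x / ln 2.

Definition log2_pos {R : realType} (x : R) : R := Num.max (log2 x) 0.

Section cascade.
Context {R : realType} {d} {Omega : measurableType d} {P : probability Omega R}.

Definition mutually_independent (I : eqType) (D : set I)
    (X : I -> {RV P >-> R}) :=
  forall (s : seq I) (B : I -> set R), uniq s ->
    (forall i, i \in s -> D i) -> (forall i, measurable (B i)) ->
  P (\bigcap_(i in [set` s]) (X i @^-1` B i)) =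
  (\prod_(i <- s) P (X i @^-1` B i))%E.

Definition identically_distributed {d0} {T0 : measurableType d0}
    {P0 : probability T0 R} (X : {RV P >-> R}) (Y : {RV P0 >-> R}) :=
  forall B : set R, measurable B -> distribution P X B = distribution P0 Y B.

Definition nonempty_words : set (seq bool) := [set u | u != [::]].

Definition iid_copies {d0} {T0 : measurableType d0} {P0 : probability T0 R}
    (W : {RV P0 >-> R}) (Wu : seq bool -> {RV P >-> R}) :=
  mutually_independent nonempty_words Wu /\
  forall u, nonempty_words u -> identically_distributed (Wu u) W.

Definition left_endpoint (u : seq bool) : R :=
  \sum_(j < size u) (nth false u j)%:R / 2 ^+ j.+1.

Definition dyadic_arc (u : seq bool) : set (circle R) :=
  circle_pi @` `[left_endpoint u, left_endpoint u + 2 ^- size u[.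

Variable Wu : seq bool -> {RV P >-> R}.

Definition amplitude (u : seq bool) (w : Omega) : R :=
  2 ^- size u * \prod_(1 <= k < (size u).+1) Wu (take k u) w.

Definition cascade_density (n : nat) (w : Omega) (x : circle R) : R :=
  \sum_(u : n.-tuple bool) 2 ^+ n * amplitude u w * \1_(dyadic_arc u) x.

(* A set function rather than a bundled measure: it is a measure as soon as   *)
(* the density is nonnegative, which holds only almost surely in w.           *)
Definition cascade_approx (n : nat) (w : Omega) (A : set (circle R)) : \bar R :=
  (\int[haar R]_(x in A) (cascade_density n w x)%:E)%E.

End cascade.

Definition weak_cvg {R : realType} (nu : nat -> set (circle R) -> \bar R)
    (mu : set (circle R) -> \bar R) :=
  forall f : circle R -> R, continuous f ->
  ((\int[nu n]_x (f x)%:E)%E @[n --> \oo] --> (\int[mu]_x (f x)%:E)%E).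

(* mu is (a version of) the cascade measure: it is determined up to a null    *)
(* set, finite Borel measures being separated by continuous functions.        *)
Definition is_dyadic_cascade {R : realType} {d} {Omega : measurableType d}
    {P : probability Omega R} (Wu : seq bool -> {RV P >-> R})
    (mu : Omega -> {finite_measure set (circle R) -> \bar R}) :=
  {ae P, forall w, weak_cvg (fun n => cascade_approx Wu n w) (mu w)}.

Section plane.
Context {R : realType}.
Implicit Types x y : R * R.

Definition dot x y : R := x.1 * y.1 + x.2 * y.2.

(* The library norm on R * R is the sup norm.                                 *)
Definition euclidean_norm x : R := Num.sqrt (dot x x).

Definition det2 x y : R := x.1 * y.2 - x.2 * y.1.

Definition fourier (nu : set (R * R) -> \bar R) (xi : R * R) : R[i] :=
  Complex (fine (\int[nu]_x (cos (2 * pi * dot xi x))%:E)%E)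
          (- fine (\int[nu]_x (sin (2 * pi * dot xi x))%:E)%E).

Definition vanishes_at_infinity (g : R * R -> R[i]) :=
  forall e : R, 0 < e -> exists M : R, forall xi,
    M < euclidean_norm xi -> Normc.normc (g xi) < e.

Definition lift (Gamma : circle R -> R * R) : R -> R * R := Gamma \o circle_pi.

Definition C2 (g : R -> R * R) :=
  [/\ forall t, derivable g t 1, forall t, derivable (g^`())%classic t 1
    & continuous (g^`(2))%classic].

Definition topological_embedding {T U : topologicalType} (f : T -> U) :=
  [/\ continuous f, injective f &
    forall A : set T, open A ->
      exists2 B : set U, open B & f @` A = range f `&` B].

Definition nondegenerate_C2_Jordan_curve (Gamma : circle R -> R * R) :=
  [/\ topological_embedding Gamma, C2 (lift Gamma),
    0 < inf (range (fun t => euclidean_norm ((lift Gamma)^`()%classic t))) &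
    0 < inf (range (fun t =>
          `|det2 ((lift Gamma)^`()%classic t) ((lift Gamma)^`(2)%classic t)|))].

End plane.

(* Main.v *)
From HB Require Import structures.
Require Import Defs.
From mathcomp Require Import all_boot all_order all_algebra.
From mathcomp Require Import generic_quotient ring_quotient.
From mathcomp Require Import all_classical all_reals all_analysis.
From mathcomp Require Import measurable_realfun.
From mathcomp Require Import complex.
From mathcomp Require Import ring lra zify.

Set Implicit Arguments.
Unset Strict Implicit.
Unset Printing Implicit Defensive.

Import Order.TTheory GRing.Theory Num.Theory.
Import numFieldNormedType.Exports.

Local Open Scope classical_set_scope.
Local Open Scope ring_scope.


(* Truncation. Let kamp u be the amplitude of u killed as soon as some prefix  *)
(* of length k has amplitude above L beta^k, where 1/2 < beta is chosen so     *)
(* that, under the law biased by W, the walk with steps ln (W / (2 beta)) has  *)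
(* negative drift. The probability H that this walk never exceeds a given      *)
(* level makes wamp u = kamp u * H (slack) satisfy E[wamp (u i) | u] =         *)
(* wamp u / 2, and E sum_u (amp u - wamp u) = 1 - H (ln L) is small for large  *)
(* L. Each wamp u, |u| = k, is at most L beta^k; hence, for a family phi with  *)
(* phi u = (phi (u 0) + phi (u 1)) / 2, the sums of wamp u * phi u form a      *)
(* martingale whose increments have superexponentially small tails as long as  *)
(* the total mass is bounded. By Borel-Cantelli they converge at a geometric   *)
(* rate, uniformly over exponentially large sets of families.                  *)
(*                                                                             *)
(* Frequencies. For phi u the mean of exp (-2 pi i xi . Gamma) over the arc of *)
(* u, van der Corput's estimate gives |phi u| <= C 2^-n at all levels |u| = n  *)
(* with 64^n <= |xi|, and all xi of size about 64^n are approximated by the    *)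
(* points of one grid of exponential size. Starting the martingale at such an  *)
(* n bounds the Fourier transform at xi by O(2^-n) + o(1).                     *)

(** Cut the circle into its 2^n arcs of level n. If the cascade had constant density on each arc,
    the curvature of [Gamma] alone would give decay: for |xi| of order at least 64^n the first two
    derivatives of the phase xi . Gamma(t) cannot both be small compared with |xi|, so its mean over
    an arc is O(2^-n) ([sup_norm_det], [van_der_corput], [phase_oscillation]). What remains is the
    fluctuation created by the levels beyond n. It is a martingale in the level, because the mean
    over an arc is the average of the means over its two halves; but the weights have only an x log
    x moment, so it must first be made bounded.

    The condition E[W log2 W] < 1 says that the mass is carried by arcs whose amplitude at level k
    stays below L beta^k for some beta < 1. Plain truncation would destroy the martingale property.
    It is restored by weighting each surviving amplitude with the probability that the biased walk
    issued from it never crosses the barrier ([survival_harmonic], [Rintegral_wamp_step]), and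
    [survival_to1] makes the lost mass small for large L. Given the levels up to k, the next
    increment is a sum of independent terms of size at most L beta^(k+1) whose total variance is at
    most that size times the mass. The resulting exponential inequality [wsum_increment_tail] has a
    tail of order exp (- c q^k), which beats the exponential number of grid frequencies used at
    level k ([wsum_increments_small]).

    [cascade_limit_bound] adds up the initial value, the increments and the truncation loss.
    [curve_fourier_vanishes] passes from the sums to the integrals by weak convergence
    ([cascade_sum_cvg]) and from the grid to every xi by the Lipschitz dependence of the phase on
    the frequency. *)

Section real_integral.
Context d (T : measurableType d) (R : realType) (mu : {measure set T -> \bar R}).

Lemma integrable_dominated (f g : T -> R) :
  measurable_fun setT f -> (forall x, `|f x| <= g x) ->
  mu.-integrable setT (EFin \o g) -> mu.-integrable setT (EFin \o f).
Proof.
move=> mf fg; apply: le_integrable => //; first exact/measurable_EFinP.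
by move=> x _ /=; rewrite lee_fin (le_trans (fg x))// ler_norm.
Qed.

Lemma Rintegral_dominated_cvg (f_ : nat -> T -> R) (f g : T -> R) :
  (forall n, measurable_fun setT (f_ n)) ->
  (forall x, f_ ^~ x @ \oo --> f x) ->
  (forall n x, `|f_ n x| <= g x) -> mu.-integrable setT (EFin \o g) ->
  \int[mu]_x f_ n x @[n --> \oo] --> \int[mu]_x f x.
Proof.
move=> mf ff fg ig.
have mlim : measurable_fun setT f.
  by apply: (measurable_fun_cvg mf) => x _; exact: ff.
have [||||ii _ h] := @dominated_convergence _ _ _ mu setT measurableT
  (fun n x => (f_ n x)%:E) (EFin \o f) (EFin \o g) _ _ _ ig.
- by move=> n; exact/measurable_EFinP.
- exact/measurable_EFinP.
- by apply: aeW => x _; apply: cvg_EFin; [exact: nearW|exact: ff].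
- by apply: aeW => x n _ /=; rewrite lee_fin.
by apply: fine_cvg; rewrite fineK//; exact: integrable_fin_num.
Qed.

Lemma measurable_sum_seq (I : eqType) (s : seq I) (f : I -> T -> R) :
  (forall i, i \in s -> measurable_fun setT (f i)) ->
  measurable_fun setT (fun x => \sum_(i <- s) f i x).
Proof.
elim: s => [_|i s ih mf].
  by under eq_fun do rewrite big_nil; exact: measurable_cst.
under eq_fun do rewrite big_cons.
apply: measurable_funD; first by apply: mf; rewrite mem_head.
by apply: ih => j js; apply: mf; rewrite inE js orbT.
Qed.

End real_integral.

Lemma integral_probability_cst d (T : measurableType d) (R : realType)
  (P : probability T R) (c : R) : (\int[P]_x c%:E = c%:E)%E.
Proof.
rewrite integral_cst// -[RHS]mule1; congr (_ * _)%E; exact: probability_setT.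
Qed.

(** * The survival function of a biased random walk *)

Section survival.
Context d (T : measurableType d) (R : realType) (P : probability T R).
Variables w l : T -> R.
Hypotheses (w0 : forall t, 0 <= w t) (mw : measurable_fun setT w)
  (ml : measurable_fun setT l) (iw : P.-integrable setT (EFin \o w))
  (w1 : \int[P]_t w t = 1) (iwl : P.-integrable setT (EFin \o (w \* l)))
  (wl_neg : \int[P]_t (w t * l t) < 0).

(* Under the law biased by w, [surv_ n x] is the probability that the partial *)
(* sums of order 0, ..., n of the walk with steps l are all at most x.        *)
Fixpoint surv_ (n : nat) (x : R) : R :=
  if x < 0 then 0 else
  if n is n'.+1 then \int[P]_t (w t * surv_ n' (x - l t)) else 1.

(** Monotonicity travels with the bounds through the induction because it is what makes the next
    integrand measurable. *)
Let surv_props n : (forall x, 0 <= surv_ n x <= 1) /\ nondecreasing_fun (surv_ n).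
Proof.
elim: n => [|n [b nd]].
  split => [x /=|x y xy /=]; first by case: ifP; lra.
  by case: ifPn => hx; case: ifPn => hy; lra.
have ms x : measurable_fun setT (fun t => surv_ n (x - l t)).
  apply: (measurableT_comp (nondecreasing_measurable measurableT nd)).
  exact: measurable_funB.
have is_ x : P.-integrable setT (EFin \o (fun t => w t * surv_ n (x - l t))).
  apply: (integrable_dominated _ _ iw); first exact: measurable_funM.
  move=> t; have /andP[b0 b1] := b (x - l t).
  by rewrite normrM !ger0_norm// ler_piMr.
split=> [x|x y xy] /=.
  case: ifP => _; first by lra.
  rewrite Rintegral_ge0/=; last by move=> t _; rewrite mulr_ge0//; case/andP: (b (x - l t)).
  rewrite -w1; apply: le_Rintegral => // t _.
  by have /andP[b0 b1] := b (x - l t); rewrite ler_piMr.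
case: ifPn => hx.
  case: ifPn => // _; rewrite Rintegral_ge0// => t _.
  by rewrite mulr_ge0//; case/andP: (b (y - l t)).
rewrite ifF; last by apply/negbTE; rewrite -leNgt (le_trans _ xy)// leNgt.
by apply: le_Rintegral => // t _; rewrite ler_wpM2l// nd// lerB.
Qed.

Let surv_ge0 n x : 0 <= surv_ n x. Proof. by case/andP: ((surv_props n).1 x). Qed.
Let surv_le1 n x : surv_ n x <= 1. Proof. by case/andP: ((surv_props n).1 x). Qed.
Let surv_nd n : nondecreasing_fun (surv_ n). Proof. exact: (surv_props n).2. Qed.

Let msurv n x : measurable_fun setT (fun t => w t * surv_ n (x - l t)).
Proof.
apply: measurable_funM => //.
apply: (measurableT_comp (nondecreasing_measurable measurableT (@surv_nd n))).
exact: measurable_funB.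
Qed.

Let isurv n x : P.-integrable setT (EFin \o (fun t => w t * surv_ n (x - l t))).
Proof.
apply: (integrable_dominated _ _ iw); first exact: msurv.
by move=> t; rewrite normrM !ger0_norm// ler_piMr.
Qed.

Let surv_dec n x : surv_ n.+1 x <= surv_ n x.
Proof.
elim: n x => [|n ih] x /=; case: ifP => // _.
  rewrite -[leRHS]w1; apply: le_Rintegral => //; first exact: (isurv 0).
  by move=> t _; rewrite -[leRHS]mulr1 ler_wpM2l//; exact: (surv_le1 0).
apply: le_Rintegral => //; first exact: (isurv n.+1).
by move=> t _; apply: ler_wpM2l => //; exact: (ih (x - l t)).
Qed.

Definition survival (x : R) : R := limn (surv_ ^~ x).

Let surv_cvg x : surv_ ^~ x @ \oo --> survival x.
Proof.
apply: nonincreasing_is_cvgn.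
  by apply/nonincreasing_seqP => n; exact: surv_dec.
by exists 0 => _ [n _ <-].
Qed.

Lemma survival_ge0 x : 0 <= survival x.
Proof. by apply: limr_ge; [apply: surv_cvg|apply: nearW => n]. Qed.

Lemma survival_le1 x : survival x <= 1.
Proof. by apply: limr_le; [apply: surv_cvg|apply: nearW => n]. Qed.

Lemma survival_nd : nondecreasing_fun survival.
Proof.
move=> x y xy; apply: ler_lim; [exact: surv_cvg|exact: surv_cvg|].
by apply: nearW => n; exact: surv_nd.
Qed.

Lemma survival_lt0 x : x < 0 -> survival x = 0.
Proof.
move=> x0; apply/cvg_lim => //.
by apply: cvg_near_cst; apply: nearW => -[|n] /=; rewrite x0.
Qed.

Lemma measurable_survival : measurable_fun setT survival.
Proof. exact: (nondecreasing_measurable measurableT survival_nd). Qed.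

Lemma survival_harmonic x : 0 <= x ->
  survival x = \int[P]_t (w t * survival (x - l t)).
Proof.
move=> x0; apply/cvg_lim => //.
rewrite -(cvg_shiftS (surv_ ^~ x)) /= ltNge x0 /=.
apply: (Rintegral_dominated_cvg (g := w)) => //.
  by move=> t; apply: cvgMr; exact: surv_cvg.
by move=> n t; rewrite normrM !ger0_norm// ler_piMr.
Qed.

(** Harmonicity propagates the bound q to [survival <= q * surv_ n] for every n, and n tends to
    infinity. Hence a bound q < 1 forces [survival] to vanish: its supremum is 0 or 1. *)
Let survival_zero_one (q x : R) : (forall y, survival y <= q) ->
  survival x <= q * survival x.
Proof.
move=> sq; have q0 : 0 <= q := le_trans (survival_ge0 0) (sq 0).
suff sqn n y : survival y <= q * surv_ n y.
  have qx : q * surv_ n x @[n --> \oo] --> q * survival x.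
    by apply: cvgMr; exact: surv_cvg.
  rewrite -(cvg_lim _ qx)//; apply: limr_ge; first by apply/cvg_ex; eexists; exact: qx.
  exact: nearW.
elim: n y => [|n ih] y /=; case: ifPn => y0.
- by rewrite survival_lt0// mulr0.
- by rewrite mulr1.
- by rewrite survival_lt0// mulr0.
- rewrite survival_harmonic; last by rewrite leNgt.
  rewrite -RintegralZl//; apply: le_Rintegral => //.
  + apply: (integrable_dominated _ _ iw).
      apply: measurable_funM => //; apply: (measurableT_comp measurable_survival).
      exact: measurable_funB.
    move=> t; rewrite normrM !ger0_norm ?survival_ge0//.
    by rewrite ler_piMr// survival_le1.
  + by apply: (integrableZl measurableT _ (isurv n y)).
  + by move=> t _; rewrite mulrCA ler_wpM2l.
Qed.

(* [emax n x] is the expectation of max(x, M_n), where M_n is the maximum of  *)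
(* the first n partial sums of the walk (and of 0) under the law biased by w. *)
Fixpoint emax (n : nat) (x : R) : R :=
  if n is n'.+1 then
    \int[P]_t (w t * (l t + emax n' (Num.max x 0 - l t)))
  else Num.max x 0.

Let wabs := \int[P]_t (w t * `|l t|).

Let iwabs : P.-integrable setT (EFin \o (fun t => w t * `|l t|)).
Proof.
apply: eq_integrable (integrable_abse iwl) => // t _ /=.
by rewrite normrM (ger0_norm (w0 t)).
Qed.

(** Monotonicity gives measurability of the next integrand and linear growth gives its
    integrability, so the two are proved in one induction. *)
Let emax_props n :
  nondecreasing_fun (emax n) /\
  (exists c : R, forall x, `|emax n x| <= `|x| + c).
Proof.
elim: n => [|n [nd [c bc]]].
  split => [x y xy /=|]; first by rewrite ge_max !le_max xy lexx !orbT.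
  exists 0 => x /=; rewrite addr0 ger0_norm ?le_max ?lexx ?orbT//.
  by rewrite ge_max ler_norm normr_ge0.
pose f x t := w t * (l t + emax n (Num.max x 0 - l t)).
pose g (x : R) t := 2 * (w t * `|l t|) + (`|x| + c) * w t.
have mf x : measurable_fun setT (f x).
  apply: measurable_funM => //; apply: measurable_funD => //.
  apply: (measurableT_comp (nondecreasing_measurable measurableT nd)).
  exact: measurable_funB.
have ig x : P.-integrable setT (EFin \o g x).
  apply: (@integrableD _ _ _ P _ measurableT _ _
    (integrableZl measurableT 2 iwabs) (integrableZl measurableT (`|x| + c) iw)).
have fg x t : `|f x t| <= g x t.
  rewrite /f /g normrM (ger0_norm (w0 t)).
  rewrite mulrCA (mulrC _ (w t)) -mulrDr ler_wpM2l//.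
  rewrite (le_trans (ler_normD _ _))//.
  have := bc (Num.max x 0 - l t).
  have := ler_normB (Num.max x 0) (l t).
  have : `|Num.max x 0| <= `|x|.
    by rewrite ger0_norm ?le_max ?lexx ?orbT// ge_max ler_norm normr_ge0.
  lra.
have if_ x := integrable_dominated (mf x) (fg x) (ig x).
split=> [x y xy /=|].
  apply: le_Rintegral => //; [exact: if_|exact: if_|].
  move=> t _; rewrite ler_wpM2l// lerD2l nd// lerB//.
  by rewrite ge_max !le_max xy lexx !orbT.
exists (2 * wabs + c) => x /=.
apply: (le_trans (le_normr_Rintegral measurableT (if_ x))).
apply: (@le_trans _ _ (\int[P]_t g x t)).
  by apply: le_Rintegral => //; exact: (integrable_norm (if_ x)).
rewrite /g RintegralD//; last 2 first.
  exact: (integrableZl measurableT 2 iwabs).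
  exact: (integrableZl measurableT (`|x| + c) iw).
by rewrite !RintegralZl// w1 /wabs; lra.
Qed.

Let iemax n x :
  P.-integrable setT (EFin \o (fun t => w t * (l t + emax n (Num.max x 0 - l t)))).
Proof.
have [nd [c bc]] := emax_props n.
apply: (@integrable_dominated _ _ _ _ _
  (fun t => 2 * (w t * `|l t|) + (`|x| + c) * w t)).
- apply: measurable_funM => //; apply: measurable_funD => //.
  apply: (measurableT_comp (nondecreasing_measurable measurableT nd)).
  exact: measurable_funB.
- move=> t; rewrite normrM (ger0_norm (w0 t)).
  rewrite mulrCA (mulrC _ (w t)) -mulrDr ler_wpM2l//.
  rewrite (le_trans (ler_normD _ _))//.
  have := bc (Num.max x 0 - l t).
  have := ler_normB (Num.max x 0) (l t).
  have : `|Num.max x 0| <= `|x|.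
    by rewrite ger0_norm ?le_max ?lexx ?orbT// ge_max ler_norm normr_ge0.
  lra.
- apply: (@integrableD _ _ _ P _ measurableT _ _
    (integrableZl measurableT 2 iwabs) (integrableZl measurableT (`|x| + c) iw)).
Qed.

Let emax_max0 n x : emax n (Num.max x 0) = emax n x.
Proof. by case: n => [|n] /=; rewrite -maxA maxxx. Qed.

Let emax_inc n x : emax n x <= emax n.+1 x.
Proof.
elim: n x => [|n ih] x /=.
  rewrite -[leLHS]mul1r -w1 -RintegralZr//.
  have iwx : P.-integrable setT (EFin \o (fun t => w t * Num.max x 0)).
    by apply: eq_integrable (integrableZl measurableT (Num.max x 0) iw) => // t _ /=; rewrite mulrC.
  apply: le_Rintegral => //; first exact: (iemax 0).
  move=> t _; rewrite ler_wpM2l//.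
  by rewrite -lerBlDl le_max lexx.
apply: le_Rintegral => // [|t _]; first exact: (iemax n.+1).
by rewrite ler_wpM2l// lerD2l.
Qed.

(** E max(x, M_n) is convex in x, with slope at x the probability that M_n is at most x; a secant
    slope is bounded by the slope at its right end. *)
Let emax_slope n x y : y <= x -> emax n x - emax n y <= (x - y) * surv_ n x.
Proof.
elim: n x y => [|n ih] x y yx /=.
  case: ifPn => x0.
    rewrite max_r ?(ltW x0)// max_r ?mulr0 ?subrr//.
    exact: le_trans yx (ltW x0).
  by rewrite -leNgt in x0; rewrite mulr1 max_l// lerB// le_max lexx.
case: ifPn => x0.
  rewrite (max_r (ltW x0)) max_r ?subrr ?mulr0//.
  exact: le_trans yx (ltW x0).
rewrite -leNgt in x0; rewrite -RintegralB//.
have y0 : Num.max y 0 <= Num.max x 0 by rewrite ge_max !le_max yx lexx !orbT.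
apply: (@le_trans _ _ (\int[P]_t ((x - Num.max y 0) * (w t * surv_ n (x - l t))))).
  apply: le_Rintegral => //.
  - exact: (integrableB measurableT (iemax n x) (iemax n y)).
  - exact: (integrableZl measurableT _ (isurv n x)).
  - move=> t _; rewrite -mulrBr [leRHS]mulrCA ler_wpM2l//.
    have := ih _ _ (lerB y0 (lexx (l t))).
    rewrite (max_l x0); lra.
rewrite RintegralZl// ler_wpM2r ?Rintegral_ge0//.
  by move=> t _; rewrite mulr_ge0.
by rewrite lerB// le_max lexx.
Qed.

(* If the survival function vanished, E max(x, M_n) would become flat in x,   *)
(* and the monotonicity of E M_n in n would force a nonnegative drift.        *)
Let survival_neq0 : exists x, 0 < survival x.
Proof.
apply: contrapT => ns.
have s0 x : survival x = 0.
  apply/eqP; rewrite eq_le survival_ge0 andbT leNgt; apply/negP => sx.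
  by apply: ns; exists x.
pose f n t := w t * (l t + (emax n (- l t) - emax n 0)).
have key n : 0 <= \int[P]_t f n t.
  have -> : \int[P]_t f n t = emax n.+1 0 - emax n 0; last by rewrite subr_ge0 emax_inc.
  rewrite /= maxxx -[X in _ - X]mul1r -w1 -RintegralZr// -RintegralB//.
  - by apply: eq_Rintegral => t _; rewrite /f sub0r; lra.
  - by have := iemax n 0; rewrite maxxx.
  - by apply: eq_integrable (integrableZl measurableT (emax n 0) iw) => // t _ /=; rewrite mulrC.
have bnd n t : 0 <= emax n (- l t) - emax n 0 <= `|l t| * surv_ n `|l t|.
  have [l0|l0] := lerP 0 (l t).
    by rewrite -(emax_max0 n (- l t)) max_r ?oppr_le0// subrr lexx mulr_ge0.
  rewrite subr_ge0 (emax_props n).1 ?oppr_ge0 ?(ltW l0)//=.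
  rewrite ltr0_norm// (le_trans (emax_slope _ _))// ?oppr_ge0 ?(ltW l0)//.
  by rewrite subr0.
have cvg : \int[P]_t f n t @[n --> \oo] --> \int[P]_t (w t * l t).
  apply: (Rintegral_dominated_cvg (g := fun t => 2 * (w t * `|l t|))) => //.
  - move=> n; apply: measurable_funM => //; apply: measurable_funD => //.
    apply: measurable_funB => //.
    apply: (measurableT_comp (nondecreasing_measurable measurableT (emax_props n).1)).
    exact: measurable_funN.
  - move=> t; apply: cvgMr; rewrite -[X in _ --> X]addr0; apply: cvgD.
      exact: cvg_cst.
    apply: (@squeeze_cvgr _ _ _ _ (cst 0) (fun n => `|l t| * surv_ n `|l t|)).
    + by apply: nearW => n; exact: bnd.
    + exact: cvg_cst.
    + by rewrite -(mulr0 `|l t|) -(s0 `|l t|); apply: cvgMr; exact: surv_cvg.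
  - move=> n t; rewrite /f normrM (ger0_norm (w0 t)) mulrCA ler_wpM2l//.
    have /andP[b0 b1] := bnd n t; rewrite (le_trans (ler_normD _ _))//.
    rewrite (ger0_norm b0).
    suff : `|l t| * surv_ n `|l t| <= `|l t| by lra.
    by rewrite ler_piMr.
  - exact: (integrableZl measurableT 2 iwabs).
have : 0 <= \int[P]_t (w t * l t).
  by rewrite -(cvg_lim _ cvg)//; apply: limr_ge; [apply/cvg_ex; eexists; exact: cvg|exact: nearW].
by rewrite leNgt wl_neg.
Qed.

Lemma survival_to1 (e : R) : 0 < e -> exists x, 1 - e < survival x.
Proof.
move=> e0; have [x sx] := survival_neq0; apply: contrapT => ns.
have /(survival_zero_one x) : forall y, survival y <= 1 - e.
  by move=> y; rewrite leNgt; apply/negP => sy; apply: ns; exists y.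
nra.
Qed.

End survival.

(** * Independence of one variable from all the others *)

Section independence.
Context (R : realType) d (Omega : measurableType d) (P : probability Omega R)
  (I : eqType) (D : set I) (X : I -> {RV P >-> R}).
Hypothesis indep : mutually_independent D X.
Variable v : I.
Hypothesis Dv : D v.

Definition others_events : set (set Omega) :=
  [set A | exists i, exists B, [/\ D i, i != v, measurable B & A = X i @^-1` B]].

(** [Omega] again, with the coarser sigma-algebra generated by the [X i], i in [D] other than v.
    Measurability of a function on [others] expresses that it does not look at [X v]. *)
Definition others := g_sigma_algebraType others_events.

Let cylinders : set (set Omega) :=
  [set A | exists s : seq I, exists B : I -> set R,
    [/\ uniq s, forall i, i \in s -> D i /\ i != v,
        forall i, measurable (B i) &
        A = \bigcap_(i in [set` s]) (X i @^-1` B i)]].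

Let mX (i : I) (B : set R) : measurable B -> measurable (X i @^-1` B).
Proof. by move=> mB; rewrite -[X in measurable X]setTI; exact: measurable_funPT. Qed.

Let cylinders_measurable A : cylinders A -> measurable A.
Proof.
move=> [s [B [_ _ mB ->]]].
by apply: fin_bigcap_measurable => // i _; exact: mX.
Qed.

Let cylindersI : setI_closed cylinders.
Proof.
move=> _ _ [s1 [B1 [u1 D1 m1 ->]]] [s2 [B2 [u2 D2 m2 ->]]].
exists (undup (s1 ++ s2)).
exists (fun i => (if i \in s1 then B1 i else setT) `&`
                 (if i \in s2 then B2 i else setT)); split.
- exact: undup_uniq.
- by move=> i; rewrite mem_undup mem_cat => /orP[/D1|/D2].
- by move=> i; apply: measurableI; case: ifP.
- apply/seteqP; split=> [w [h1 h2] i /=|w h].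
    rewrite mem_undup mem_cat => _; split.
      by case: ifP => // is1; exact: h1.
    by case: ifP => // is2; exact: h2.
  split=> i /= is_.
    by have := h i; rewrite /= mem_undup mem_cat is_ => /(_ isT) [].
  have := h i; rewrite /= mem_undup mem_cat is_ orbT => /(_ isT) [].
  by rewrite /= => _.
Qed.

Let cylinders_indep A C : cylinders A -> measurable C ->
  P (A `&` X v @^-1` C) = (P A * P (X v @^-1` C))%E.
Proof.
move=> [s [B [us Ds mB ->]]] mC.
have vs : v \notin s by apply/negP => /Ds[_]; rewrite eqxx.
pose B' i := if i == v then C else B i.
have eB' i : i \in s -> B' i = B i.
  by move=> /Ds[_ /negbTE iv]; rewrite /B' iv.
have mB' i : measurable (B' i) by rewrite /B'; case: ifP.
have := indep (s := v :: s) (B := B').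
rewrite /= vs us => /(_ isT) /=.
rewrite big_cons {3}/B' eqxx.
rewrite (_ : \bigcap_(i in [set` v :: s]) _ =
   (\bigcap_(i in [set` s]) (X i @^-1` B i)) `&` X v @^-1` C); last first.
  apply/seteqP; split=> [w h|w [h1 h2] i /=].
    split=> [i is_|]; first by rewrite -eB'//; apply: h; rewrite /= inE is_ orbT.
    by have := h v; rewrite /= inE eqxx /B' eqxx; exact.
  rewrite inE => /orP[/eqP ->|is_]; first by rewrite /B' eqxx.
  by rewrite eB'//; exact: h1.
move=> -> //; last by move=> i; rewrite inE => /orP[/eqP ->//|/Ds[]].
rewrite muleC; congr (_ * _)%E.
have := indep us (fun i is_ => (Ds i is_).1) mB => ->.
by apply: eq_big_seq => i is_; rewrite eB'.
Qed.

Let others_sub_cylinders : <<s others_events >> `<=` <<s cylinders >>.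
Proof.
apply: smallest_sub; first exact: smallest_sigma_algebra.
move=> _ [i [B [Di iv mB ->]]]; apply: sub_sigma_algebra.
exists [:: i], (fun=> B); split => //.
  by move=> j; rewrite inE => /eqP ->.
apply/seteqP; split=> [w h j|w]; first by rewrite /= inE => /eqP ->.
by apply; rewrite /= inE.
Qed.

Lemma others_measurable (A : set Omega) :
  measurable (A : set others) -> measurable A.
Proof.
move=> mA; suff : <<s others_events >> `<=` measurable by apply.
apply: smallest_sub; first exact: sigma_algebra_measurable.
by move=> _ [i [B [_ _ mB ->]]]; exact: mX.
Qed.

(** Finite cylinders are stable under intersection and generate the sigma-algebra of [others]; the
    events independent of [X v] form a Dynkin system containing them. *)
Lemma others_indep (A : set Omega) C : measurable (A : set others) -> measurable C ->
  P (A `&` X v @^-1` C) = (P A * P (X v @^-1` C))%E.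
Proof.
move=> mA mC; pose H := [set A | measurable A /\
  P (A `&` X v @^-1` C) = (P A * P (X v @^-1` C))%E].
suff : <<s cylinders >> `<=` H by move=> /(_ _ (others_sub_cylinders mA)) [].
have mXC := mX v mC.
rewrite -setI_closed_g_dynkin_g_sigma_algebra//.
apply: smallest_sub; last first.
  by move=> B cB; split; [exact: cylinders_measurable|exact: cylinders_indep].
have PC : P (X v @^-1` C) \is a fin_num by exact: fin_num_measure.
split.
- by split; rewrite // setTI probability_setT mul1e.
- move=> B [mB eB]; split; first exact: measurableC.
  rewrite setIC -setDE measureD//; last first.
    by rewrite -ge0_fin_numE//.
  rewrite probability_setC// muleBl//.
  by rewrite mul1e; congr (_ - _)%E; rewrite -eB setIC.
- move=> F tF HF; have mF n : measurable (F n) := (HF n).1.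
  split; first exact: bigcup_measurable.
  rewrite setI_bigcupl measure_bigcup//=; last 2 first.
    by move=> i _; exact: measurableI.
    exact: trivIset_setIr.
  rewrite measure_bigcup//= muleC -(fineK PC) -nneseriesZl//.
  by apply: eq_eseriesr => i _; rewrite (HF i).2 muleC fineK.
Qed.

Lemma measurable_others_le d' (T' : measurableType d') (f : Omega -> T') :
  measurable_fun setT (f : others -> T') -> measurable_fun setT f.
Proof.
by move=> mf _ A mA; rewrite setTI; apply: others_measurable;
   rewrite -[X in measurable X]setTI; exact: mf.
Qed.

Definition to_others : Omega -> others := id.

Let mto_others : measurable_fun setT to_others.
Proof. by move=> _ A mA; rewrite setTI; exact: others_measurable. Qed.

HB.instance Definition _ := isMeasurableFun.Build _ _ _ _ to_others mto_others.

Definition others_pair (w : Omega) : others * R := (to_others w, X v w).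

Let mpair : measurable_fun setT others_pair.
Proof. by apply: measurable_fun_pair => //; exact: measurable_funPT. Qed.

HB.instance Definition _ := isMeasurableFun.Build _ _ _ _ others_pair mpair.

Lemma measurable_others i : D i -> i != v ->
  measurable_fun setT (X i : others -> R).
Proof.
move=> Di iv _ B mB; rewrite setTI; apply: sub_sigma_algebra.
by exists i, B.
Qed.

(** The joint law of the identity map into [others] and of [X v] is a product measure, so Tonelli
    applies. This plays the role of conditioning on all variables but [X v]. *)
Lemma integral_others_pair (F : others * R -> \bar R) :
  measurable_fun setT F -> (forall x, (0 <= F x)%E) ->
  (\int[P]_w F (w, X v w) =
   \int[P]_w \int[distribution P (X v)]_y F (w, y))%E.
Proof.
move=> mF F0.
have -> : (\int[P]_w F (w, X v w) = \int[pushforward P others_pair]_z F z)%E.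
  by rewrite ge0_integral_pushforward//; exact: measurable_funPT.
pose m1 : {measure set others -> \bar R} := distribution P to_others.
pose m2 : {measure set R -> \bar R} := distribution P (X v).
have -> : (\int[pushforward P others_pair]_z F z = \int[m1 \x m2]_z F z)%E.
  apply: eq_measure_integral => A mA _; symmetry.
  apply: (product_measure_unique) => // B C mB mC.
  by rewrite /= /pushforward /= -(others_indep mB mC).
rewrite fubini_tonelli1// /m1 /distribution ge0_integral_pushforward//.
- exact: measurable_fun_fubini_tonelli_F.
- by move=> y _; apply: integral_ge0.
Qed.

End independence.

(** * The truncated cascade *)

Section truncated_cascade.
Context (R : realType).
Implicit Types (Y : seq bool -> R) (u r : seq bool) (y : R).

Definition pos_part y : R := Num.max y 0.

Lemma pos_part_ge0 y : 0 <= pos_part y.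
Proof. by rewrite le_max lexx orbT. Qed.

Lemma measurable_pos_part : measurable_fun setT pos_part.
Proof. exact: measurable_maxr. Qed.

Fixpoint words (n : nat) : seq (seq bool) :=
  if n is n'.+1 then [seq rcons u i | u <- words n', i <- [:: false; true]]
  else [:: [::]].

Lemma size_words n u : u \in words n -> size u = n.
Proof.
elim: n u => [|n ih] u; first by rewrite inE => /eqP ->.
by move=> /allpairsP[[v i] [/= /ih <- _ ->]]; rewrite size_rcons.
Qed.

Lemma mem_words n u : size u = n -> u \in words n.
Proof.
elim: n u => [|n ih] u; first by move/size0nil ->; rewrite inE.
case/lastP: u => [//|u i]; rewrite size_rcons => -[su].
by apply/allpairsP; exists (u, i); split => //=; [exact: ih|case: i].
Qed.

Lemma uniq_words n : uniq (words n).
Proof.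
elim: n => [//|n ih]; apply: allpairs_uniq => //.
by move=> [u i] [v j] _ _ /= /rcons_inj.
Qed.

Lemma big_words_recr (V : nmodType) n (F : seq bool -> V) :
  \sum_(u <- words n.+1) F u =
  \sum_(u <- words n) (F (rcons u false) + F (rcons u true)).
Proof.
rewrite -[words n.+1]/[seq rcons u i | u <- words n, i <- [:: false; true]].
rewrite big_allpairs_dep; apply: eq_bigr => u _.
by rewrite big_cons big_seq1.
Qed.

(** Weights sit on prefixes, so the natural recursion removes the last letter; it is structural on
    the reversed word. The positive part keeps amplitudes nonnegative for every outcome, not just
    almost surely. *)
Fixpoint amp_rev Y r : R :=
  if r is i :: r' then amp_rev Y r' * pos_part (Y (rev r)) / 2 else 1.

Definition amp Y u := amp_rev Y (rev u).

Lemma amp_rcons Y u i : amp Y (rcons u i) = amp Y u * pos_part (Y (rcons u i)) / 2.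
Proof. by rewrite /amp rev_rcons /= rev_cons revK. Qed.

Lemma amp_ge0 Y u : 0 <= amp Y u.
Proof.
elim/last_ind: u => [|u i ih]; first by rewrite ler01.
by rewrite amp_rcons divr_ge0// mulr_ge0// pos_part_ge0.
Qed.

Variables (beta L : R).
Hypotheses (beta_gt0 : 0 < beta) (L_ge1 : 1 <= L).

Fixpoint kamp_rev Y r : R :=
  if r is i :: r' then
    let a := kamp_rev Y r' * pos_part (Y (rev r)) / 2 in
    if a <= L * beta ^+ size r then a else 0
  else 1.

(* The amplitude of [u], set to 0 as soon as some prefix of length k has      *)
(* amplitude larger than [L * beta ^+ k].                                     *)
Definition kamp Y u := kamp_rev Y (rev u).

Lemma kamp_rcons Y u i :
  kamp Y (rcons u i) =
  let a := kamp Y u * pos_part (Y (rcons u i)) / 2 in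
  if a <= L * beta ^+ (size u).+1 then a else 0.
Proof. by rewrite /kamp rev_rcons /= rev_cons revK size_rev. Qed.

Let bound_gt0 n : 0 < L * beta ^+ n.
Proof. by rewrite mulr_gt0 ?exprn_gt0// (lt_le_trans ltr01). Qed.

Lemma kamp_ge0 Y u : 0 <= kamp Y u.
Proof.
elim/last_ind: u => [|u i ih]; first by rewrite ler01.
rewrite kamp_rcons /=; case: ifP => // _.
by rewrite divr_ge0// mulr_ge0// pos_part_ge0.
Qed.

Lemma kamp_le Y u : kamp Y u <= L * beta ^+ size u.
Proof.
case/lastP: u => [|u i]; first by rewrite expr0 mulr1.
by rewrite kamp_rcons size_rcons /=; case: ifP => // _; exact: ltW.
Qed.

Lemma kamp_amp Y u : kamp Y u <= amp Y u.
Proof.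
elim/last_ind: u => [|u i ih]; first exact: lexx.
rewrite kamp_rcons amp_rcons /=; case: ifP => _.
  by rewrite ler_pM2r// ler_wpM2r// pos_part_ge0.
by rewrite divr_ge0// mulr_ge0 ?pos_part_ge0 ?amp_ge0.
Qed.

Variable H : R -> R.
Hypotheses (H_ge0 : forall x, 0 <= H x) (H_le1 : forall x, H x <= 1)
  (H_lt0 : forall x, x < 0 -> H x = 0) (mH : measurable_fun setT H).

Definition slack Y u := ln (L * beta ^+ size u) - ln (kamp Y u).

(* [H] being the survival function of the walk, this is the conditional mean  *)
(* of the mass that will never be truncated below [u].                        *)
Definition wamp Y u := kamp Y u * H (slack Y u).

Lemma wamp_nil Y : wamp Y [::] = H (ln L).
Proof. by rewrite /wamp /slack /kamp /= expr0 mulr1 ln1 subr0 mul1r. Qed.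

Lemma wamp_ge0 Y u : 0 <= wamp Y u.
Proof. by rewrite mulr_ge0// kamp_ge0. Qed.

Lemma wamp_le Y u : wamp Y u <= L * beta ^+ size u.
Proof.
by apply: le_trans (kamp_le Y u); rewrite ler_piMr// kamp_ge0.
Qed.

Lemma wamp_amp Y u : wamp Y u <= amp Y u.
Proof.
by apply: le_trans (kamp_amp Y u); rewrite ler_piMr// kamp_ge0.
Qed.

Lemma slack_ge0 Y u : 0 < kamp Y u -> 0 <= slack Y u.
Proof. by move=> k0; rewrite subr_ge0 ler_ln ?posrE// kamp_le. Qed.

Definition wamp_step (r x y : R) :=
  r / 2 * (pos_part y * H (x - ln (pos_part y / (2 * beta)))).

(** Passing to a child lowers the slack by ln (y / (2 beta)), which is one step of the walk. A
    truncated child has negative slack, where [H] vanishes, so the truncation test is already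
    contained in [H]. *)
Lemma wamp_rcons Y u i :
  wamp Y (rcons u i) = wamp_step (kamp Y u) (slack Y u) (Y (rcons u i)).
Proof.
rewrite /wamp /slack kamp_rcons size_rcons /wamp_step.
set y := pos_part _; set r := kamp Y u; set k := size u.
(* When r or y is 0 the logarithms take default values, but both sides carry a zero factor. *)
have [r0|r0] := eqVneq r 0; first by rewrite r0 !mul0r if_same !mul0r.
have [y0|y0] := eqVneq y 0; first by rewrite y0 mulr0 !mul0r if_same !mul0r mulr0.
have {r0} r0 : 0 < r by rewrite lt_neqAle eq_sym r0 kamp_ge0.
have {y0} y0 : 0 < y by rewrite lt_neqAle eq_sym y0 pos_part_ge0.
have a0 : 0 < r * y / 2 by rewrite divr_gt0// mulr_gt0.
have L0 : 0 < L by rewrite (lt_le_trans ltr01).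
have E : ln (L * beta ^+ k) - ln r - ln (y / (2 * beta)) =
         ln (L * beta ^+ k.+1) - ln (r * y / 2).
  rewrite -!ln_div ?posrE ?divr_gt0 ?mulr_gt0 ?exprn_gt0//.
  congr ln; rewrite exprS; field.
  by rewrite !gt_eqF.
rewrite E /=; case: ifPn => h; first by ring.
rewrite mul0r H_lt0 ?mulr0//.
by rewrite subr_lt0 ltr_ln ?posrE// ltNge.
Qed.

Section measurability.
Context d (T : measurableType d) (Z : seq bool -> T -> R).

Lemma measurable_amp u :
  (forall k, (k < size u)%N -> measurable_fun setT (Z (take k.+1 u))) ->
  measurable_fun setT (fun t => amp (Z ^~ t) u).
Proof.
elim/last_ind: u => [|u i ih] mZ; first exact: measurable_cst.
under eq_fun do rewrite amp_rcons.
apply: measurable_funM => //; apply: measurable_funM.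
  apply: ih => k ku; have := mZ k; rewrite size_rcons leqW// => /(_ isT).
  by rewrite -cats1 takel_cat.
apply: (measurableT_comp measurable_pos_part).
by have := mZ (size u); rewrite size_rcons -(size_rcons u i) take_size; apply.
Qed.

Lemma measurable_kamp u :
  (forall k, (k < size u)%N -> measurable_fun setT (Z (take k.+1 u))) ->
  measurable_fun setT (fun t => kamp (Z ^~ t) u).
Proof.
elim/last_ind: u => [|u i ih] mZ; first exact: measurable_cst.
under eq_fun do rewrite kamp_rcons.
have ma : measurable_fun setT
    (fun t => kamp (Z ^~ t) u * pos_part (Z (rcons u i) t) / 2).
  apply: measurable_funM => //; apply: measurable_funM.
    apply: ih => k ku; have := mZ k; rewrite size_rcons leqW// => /(_ isT).
    by rewrite -cats1 takel_cat.
  apply: (measurableT_comp measurable_pos_part).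
  by have := mZ (size u); rewrite size_rcons -(size_rcons u i) take_size; apply.
apply: measurable_fun_ifT => //.
exact: measurable_fun_ler.
Qed.

Lemma measurable_slack u :
  (forall k, (k < size u)%N -> measurable_fun setT (Z (take k.+1 u))) ->
  measurable_fun setT (fun t => slack (Z ^~ t) u).
Proof.
move=> mZ; apply: measurable_funB => //.
exact: (measurableT_comp (@measurable_ln R) (measurable_kamp mZ)).
Qed.

Lemma measurable_wamp u :
  (forall k, (k < size u)%N -> measurable_fun setT (Z (take k.+1 u))) ->
  measurable_fun setT (fun t => wamp (Z ^~ t) u).
Proof.
move=> mZ; apply: measurable_funM; first exact: measurable_kamp.
exact: (measurableT_comp mH (measurable_slack mZ)).
Qed.

Lemma measurable_wamp_step (f g h : T -> R) :
  measurable_fun setT f -> measurable_fun setT g -> measurable_fun setT h ->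
  measurable_fun setT (fun t => wamp_step (f t) (g t) (h t)).
Proof.
move=> mf mg mh; apply: measurable_funM; first exact: measurable_funM.
have mp : measurable_fun setT (fun t => pos_part (h t)).
  exact: (measurableT_comp measurable_pos_part mh).
apply: measurable_funM => //; apply: (measurableT_comp mH).
apply: measurable_funB => //; apply: (measurableT_comp (@measurable_ln R)).
exact: measurable_funM.
Qed.

End measurability.

Section one_step.
Variable rho : probability R R.
Hypothesis H_harm : forall x, 0 <= x ->
  H x = \int[rho]_y (pos_part y * H (x - ln (pos_part y / (2 * beta)))).
Hypothesis ipos : rho.-integrable setT (EFin \o pos_part).

Lemma wamp_step_ge0 (r x y : R) : 0 <= r -> 0 <= wamp_step r x y.
Proof. by move=> r0; rewrite mulr_ge0 ?divr_ge0// mulr_ge0 ?pos_part_ge0. Qed.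

Lemma wamp_step_le Y u y :
  wamp_step (kamp Y u) (slack Y u) y <= L * beta ^+ (size u).+1.
Proof.
(* [Y'] realizes the arbitrary value y as the weight of a child of u without changing [kamp] at u,
   so the bound on genuine amplitudes applies. *)
pose Y' (v : seq bool) := if (size v <= size u)%N then Y v else y.
have kE v : (size v <= size u)%N -> kamp Y' v = kamp Y v.
  elim/last_ind: v => [//|v i ih]; rewrite size_rcons => vu.
  by rewrite !kamp_rcons ih ?(ltnW vu)// /Y' size_rcons vu.
have := wamp_rcons Y' u false.
have -> : Y' (rcons u false) = y by rewrite /Y' size_rcons ltnn.
rewrite /slack kE// => <-.
by have := wamp_le Y' (rcons u false); rewrite size_rcons.
Qed.

Lemma integrable_wamp_step (r x : R) :
  rho.-integrable setT (EFin \o wamp_step r x).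
Proof.
suff h : rho.-integrable setT
    (EFin \o (fun y => pos_part y * H (x - ln (pos_part y / (2 * beta))))).
  exact: (integrableZl measurableT (r / 2) h).
apply: (integrable_dominated _ _ ipos).
  apply: measurable_funM => //; first exact: measurable_pos_part.
  apply: (measurableT_comp mH); apply: measurable_funB => //.
  apply: (measurableT_comp (@measurable_ln R)).
  by apply: measurable_funM => //; exact: measurable_pos_part.
by move=> y; rewrite normrM !ger0_norm ?pos_part_ge0// ler_piMr// pos_part_ge0.
Qed.

(** The martingale property: harmonicity of [H] is used at the slack of u, which is nonnegative as
    soon as [kamp Y u] is positive. *)
Lemma Rintegral_wamp_step Y u :
  \int[rho]_y wamp_step (kamp Y u) (slack Y u) y = wamp Y u / 2.
Proof.
have [k0|k0] := eqVneq (kamp Y u) 0.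
  rewrite /wamp /wamp_step k0 !mul0r.
  by under eq_Rintegral do rewrite mul0r; rewrite Rintegral_cst// mul0r.
have {k0} k0 : 0 < kamp Y u by rewrite lt_neqAle eq_sym k0 kamp_ge0.
rewrite /wamp_step RintegralZl//; last first.
  have := integrable_wamp_step 2 (slack Y u).
  by apply: eq_integrable => // y _; rewrite /= /wamp_step divff// mul1r.
by rewrite -H_harm ?slack_ge0// /wamp; ring.
Qed.

End one_step.

End truncated_cascade.

(** * An exponential moment bound for bounded variables *)

Section exponential_moment.
Context d (T : measurableType d) (R : realType) (rho : probability T R).

(** exp z <= 1 / (1 - z), and (1 - z) (1 + z + 2 z^2) = 1 + z^2 (1 - 2 z) >= 1. *)
Lemma expR_le_quadratic (z : R) : z <= 1 / 2 -> expR z <= 1 + z + 2 * z ^+ 2.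
Proof.
move=> z2; have z1 : 0 < 1 - z by lra.
have h : 1 - z <= expR (- z) by have := expR_ge1Dx (- z); lra.
rewrite -[expR z]invrK -expRN.
apply: (@le_trans _ _ (1 - z)^-1); first by rewrite lef_pV2 ?posrE ?expR_gt0.
rewrite -[leLHS]mul1r ler_pdivrMr//; nra.
Qed.

(** A variable with values in [0, b] and mean tau has variance at most b tau - tau^2. The
    compensator is therefore linear in tau, so that over a whole level the compensators add up to a
    multiple of the total mass. *)
Lemma exponential_moment (g : T -> R) (b tau lam phi : R) :
  measurable_fun setT g -> (forall y, 0 <= g y <= b) ->
  tau = \int[rho]_y g y -> 0 <= lam -> lam * b <= 1 / 2 -> `|phi| <= 1 ->
  (\int[rho]_y (expR (lam * (phi * (g y - tau)) - 2 * lam ^+ 2 * b * tau))%:E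
     <= 1)%E.
Proof.
move=> mg gb tauE lam0 lamb phi1.
have ig : rho.-integrable setT (EFin \o g).
  apply: (integrable_dominated (g := cst b)) => //.
    by move=> y; case/andP: (gb y) => g0 g1; rewrite ger0_norm.
  exact: finite_measure_integrable_cst.
have tau0 : 0 <= tau by rewrite tauE Rintegral_ge0// => y _; case/andP: (gb y).
have taub : tau <= b.
  rewrite tauE -[leRHS]mulr1 -(_ : fine (rho setT) = 1); last by rewrite probability_setT.
  rewrite -Rintegral_cst//; apply: le_Rintegral => //.
    exact: finite_measure_integrable_cst.
  by move=> y _; case/andP: (gb y).
(* Replacing g^2 by b g in the quadratic bound leaves the affine majorant [c1 * g + c0], whose mean
   is 1 + 2 lam^2 (b tau - tau^2). *)
pose c1 := lam * phi + 2 * lam ^+ 2 * (b - 2 * tau).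
pose c0 := 1 - lam * phi * tau + 2 * lam ^+ 2 * tau ^+ 2.
pose E := expR (- (2 * lam ^+ 2 * b * tau)).
have pt y : expR (lam * (phi * (g y - tau)) - 2 * lam ^+ 2 * b * tau) <=
    E * (c1 * g y + c0).
  rewrite expRD mulrC ler_wpM2l ?expR_ge0//.
  have /andP[g0 g1] := gb y.
  have /ler_normlP[p1 p2] := phi1.
  apply: le_trans (expR_le_quadratic _) _.
    apply: le_trans lamb; rewrite ler_wpM2l//.
    have := ler_norm (phi * (g y - tau)); rewrite normrM.
    have : `|phi| * `|g y - tau| <= 1 * b.
      by apply: ler_pM => //; rewrite ler_norml; apply/andP; split; lra.
    lra.
  have -> : c1 * g y + c0 = 1 + lam * (phi * (g y - tau)) +
     2 * (lam ^+ 2 * (b * g y - 2 * tau * g y + tau ^+ 2)).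
    by rewrite /c1 /c0; ring.
  rewrite lerD2l ler_pM2l// exprMn ler_wpM2l ?exprn_ge0// exprMn.
  have : phi ^+ 2 <= 1 by rewrite -ler_sqrt// ?sqrtr_sqr ?sqrtr1//; nra.
  move=> phi2; apply: (@le_trans _ _ ((g y - tau) ^+ 2)).
    by rewrite ler_piMl// sqr_ge0.
  nra.
have iaff' : rho.-integrable setT (EFin \o (fun y => c1 * g y + c0)).
  have ic := finite_measure_integrable_cst rho c0 measurableT.
  exact: (integrableD measurableT (integrableZl measurableT c1 ig) ic).
have iaff : rho.-integrable setT (EFin \o (fun y => E * (c1 * g y + c0))).
  exact: (integrableZl measurableT E iaff').
apply: (@le_trans _ _ (\int[rho]_y (E * (c1 * g y + c0))%:E)%E).
  apply: ge0_le_integral => //.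
  - apply/measurable_EFinP; apply: (measurableT_comp (@measurable_expR R)).
    apply: measurable_funB => //; apply: measurable_funM => //.
    apply: measurable_funM => //; exact: measurable_funB.
  - by case/integrableP: iaff.
  - by move=> y _; rewrite lee_fin.
rewrite -[leLHS]fineK; last exact: integrable_fin_num iaff.
rewrite lee_fin -[fine _]/(\int[rho]_y (E * (c1 * g y + c0))).
rewrite RintegralZl//.
rewrite RintegralD//; last 2 first.
  exact: (integrableZl measurableT c1 ig).
  exact: finite_measure_integrable_cst.
have -> : \int[rho]_y (c1 * g y) = c1 * tau by rewrite tauE RintegralZl.
have -> : \int[rho]_y c0 = c0.
  by rewrite /Rintegral integral_cst// [X in (_ * X)%E](probability_setT rho) mule1.
have -> : E = (expR (2 * lam ^+ 2 * b * tau))^-1 by exact: expRN.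
rewrite ler_pdivrMl ?expR_gt0// mulr1.
apply: le_trans (expR_ge1Dx _).
rewrite /c1 /c0; nra.
Qed.

End exponential_moment.

Lemma take_neq_rcons (u v : seq bool) k : v != u -> (size v <= size u)%N ->
  take k v != u.
Proof.
move=> vu svu; have [kv|kv] := leqP (size v) k; first by rewrite take_oversize.
by apply: contraNneq vu => tu; move: svu; rewrite -tu size_take kv leqNgt kv.
Qed.

(** * Means and exponential tails of the truncated cascade *)

Section random_cascade.
Context (R : realType) d (Omega : measurableType d) (P : probability Omega R)
  (X : seq bool -> {RV P >-> R}) (rho : probability R R).
Hypotheses (indep : mutually_independent nonempty_words X)
  (law : forall u, nonempty_words u -> forall B, measurable B ->
     distribution P (X u) B = rho B).

Let val (w : Omega) (u : seq bool) : R := X u w.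

Lemma integral_one_step v (F : others nonempty_words X v * R -> \bar R) :
  nonempty_words v -> measurable_fun setT F -> (forall z, (0 <= F z)%E) ->
  (\int[P]_w F (w, X v w) = \int[P]_w \int[rho]_y F (w, y))%E.
Proof.
move=> v0 mF F0; rewrite (integral_others_pair indep v0 mF F0).
apply: eq_integral => w _; apply: eq_measure_integral => B mB _.
exact: law.
Qed.

Let mval u : measurable_fun setT (X u). Proof. exact: measurable_funPT. Qed.

Lemma measurable_others_prefix v u k : v != u -> (size u <= size v)%N ->
  (k < size u)%N ->
  measurable_fun setT (X (take k.+1 u) : others nonempty_words X v -> R).
Proof.
move=> vu suv ku; apply: measurable_others.
  by rewrite /nonempty_words /=; case: u ku {vu suv}.
by apply: take_neq_rcons => //; rewrite eq_sym.
Qed.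

Variables (beta L : R) (H : R -> R).
Hypotheses (beta_gt0 : 0 < beta) (L_ge1 : 1 <= L)
  (H_ge0 : forall x, 0 <= H x) (H_le1 : forall x, H x <= 1)
  (H_lt0 : forall x, x < 0 -> H x = 0) (mH : measurable_fun setT H)
  (ipos : rho.-integrable setT (EFin \o @pos_part R))
  (pos1 : \int[rho]_y pos_part y = 1)
  (H_harm : forall x, 0 <= x ->
     H x = \int[rho]_y (pos_part y * H (x - ln (pos_part y / (2 * beta))))).

Local Notation kamp := (kamp beta L).
Local Notation slack := (slack beta L).
Local Notation wamp := (wamp beta L H).
Local Notation step := (wamp_step beta H).

Let rcons_neq0 (u : seq bool) i : nonempty_words (rcons u i).
Proof. by rewrite /nonempty_words /=; case: u. Qed.

Let mprefix u i k : (k < size u)%N ->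
  measurable_fun setT (X (take k.+1 u) : others nonempty_words X (rcons u i) -> R).
Proof.
move=> ku; apply: measurable_others_prefix => //; rewrite ?size_rcons//.
by apply/eqP => /(congr1 size); rewrite size_rcons; lia.
Qed.

Let mkamp u i : measurable_fun setT
  (fun w : others nonempty_words X (rcons u i) => kamp (val w) u).
Proof.
apply: (@measurable_kamp _ beta L _ _
  (X : seq bool -> others nonempty_words X (rcons u i) -> R) u) => k.
exact: mprefix.
Qed.

Let mslack u i : measurable_fun setT
  (fun w : others nonempty_words X (rcons u i) => slack (val w) u).
Proof.
apply: (@measurable_slack _ beta L _ _
  (X : seq bool -> others nonempty_words X (rcons u i) -> R) u) => k.
exact: mprefix.
Qed.

Let pos1' : (\int[rho]_y (pos_part y)%:E = 1)%E.
Proof. by rewrite -pos1 /Rintegral fineK//; exact: (integrable_fin_num _ ipos). Qed.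

Lemma integral_amp u : (\int[P]_w (amp (val w) u)%:E = (2 ^- size u)%:E)%E.
Proof.
elim/last_ind: u => [|u i ih].
  by rewrite /amp /= expr0 invr1 integral_probability_cst.
under eq_integral do rewrite amp_rcons.
pose F (z : others nonempty_words X (rcons u i) * R) : \bar R :=
  (amp (val z.1) u * pos_part z.2 / 2)%:E.
have mamp : measurable_fun setT
    (fun w : others nonempty_words X (rcons u i) => amp (val w) u).
  by apply: (measurable_amp (Z := X : seq bool -> others _ _ _ -> R)) => k; exact: mprefix.
rewrite (integral_one_step (F := F)) => [|//||z]; last 2 first.
- apply/measurable_EFinP; apply: measurable_funM => //; apply: measurable_funM.
    exact: (measurableT_comp mamp measurable_fst).
  exact: (measurableT_comp (@measurable_pos_part R) measurable_snd).
- by rewrite lee_fin divr_ge0// mulr_ge0// ?amp_ge0// pos_part_ge0.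
have inner w : (\int[rho]_y F (w, y) = (2^-1)%:E * (amp (val w) u)%:E)%E.
  rewrite /F /=; under eq_integral do rewrite mulrAC EFinM.
  by rewrite integralZl// pos1' mule1 mulrC.
under eq_integral do rewrite inner.
rewrite ge0_integralZl_EFin//.
- by rewrite ih -EFinM size_rcons exprS invfM.
- by move=> w _; rewrite lee_fin amp_ge0.
- apply/measurable_EFinP; apply: (measurable_amp (Z := X)) => k _; exact: mval.
Qed.

Lemma integral_wamp u :
  (\int[P]_w (wamp (val w) u)%:E = (2 ^- size u * H (ln L))%:E)%E.
Proof.
elim/last_ind: u => [|u i ih].
  under eq_integral do rewrite wamp_nil.
  rewrite expr0 invr1 mul1r.
  by rewrite integral_probability_cst.
pose F (z : others nonempty_words X (rcons u i) * R) : \bar R :=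
  (step (kamp (val z.1) u) (slack (val z.1) u) z.2)%:E.
under eq_integral do rewrite wamp_rcons//.
rewrite (integral_one_step (F := F)) => [|//||z]; last 2 first.
- apply/measurable_EFinP; apply: measurable_wamp_step => //.
    exact: (measurableT_comp (@mkamp u i) measurable_fst).
  exact: (measurableT_comp (@mslack u i) measurable_fst).
- by rewrite lee_fin wamp_step_ge0// kamp_ge0.
have inner w : (\int[rho]_y F (w, y) = (2^-1)%:E * (wamp (val w) u)%:E)%E.
  rewrite -EFinM mulrC -(Rintegral_wamp_step _ _ _ _ mH H_harm ipos)//.
  rewrite /Rintegral fineK//; apply: integrable_fin_num => //.
  exact: (integrable_wamp_step beta H_ge0 H_le1 mH ipos).
under eq_integral do rewrite inner.
rewrite ge0_integralZl_EFin//.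
- by rewrite ih -EFinM size_rcons exprS invfM mulrA.
- by move=> w _; rewrite lee_fin wamp_ge0.
- by apply/measurable_EFinP; apply: (measurable_wamp _ _ mH (Z := X)) => k _; exact: mval.
Qed.

(* For each enumerated edge (u, i), the exponent carries the martingale       *)
(* increment at [rcons u i] and compensates it by its conditional mean.       *)
Lemma exponential_increment (k : nat) (lam : R) (phi : seq bool -> R)
    (s : seq (seq bool * bool)) :
  0 <= lam -> lam * (L * beta ^+ k.+1) <= 1 / 2 ->
  (forall v, `|phi v| <= 1) -> uniq s -> (forall e, e \in s -> size e.1 = k) ->
  (\int[P]_w (expR (\sum_(e <- s)
     (lam * (phi (rcons e.1 e.2) *
       (wamp (val w) (rcons e.1 e.2) - wamp (val w) e.1 / 2)) -
      2 * lam ^+ 2 * (L * beta ^+ k.+1) * (wamp (val w) e.1 / 2))))%:E <= 1)%E.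
Proof.
move=> lam0 lamb phi1; elim: s => [_ _|[u i] s ih /= /andP[us uniqs] sk].
  under eq_integral do rewrite big_nil expR0.
  by rewrite integral_probability_cst.
have su : size u = k by apply: (sk (u, i)); rewrite mem_head.
set v := rcons u i.
pose term (w : Omega) (e : seq bool * bool) : R :=
  lam * (phi (rcons e.1 e.2) *
       (wamp (val w) (rcons e.1 e.2) - wamp (val w) e.1 / 2)) -
      2 * lam ^+ 2 * (L * beta ^+ k.+1) * (wamp (val w) e.1 / 2).
(* The weight of the edge being removed becomes the second coordinate. All remaining factors involve
   words of length at most k + 1 having no prefix equal to v, hence live on [others]. *)
pose F (z : others nonempty_words X v * R) : \bar R :=
  (expR (\sum_(e <- s) term z.1 e) *
   expR (lam * (phi v * (step (kamp (val z.1) u) (slack (val z.1) u) z.2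
      - wamp (val z.1) u / 2)) -
      2 * lam ^+ 2 * (L * beta ^+ k.+1) * (wamp (val z.1) u / 2)))%:E.
have mw u' : v != u' -> (size u' <= k.+1)%N ->
    measurable_fun setT (fun w : others nonempty_words X v => wamp (val w) u').
  move=> vu' su'.
  apply: (measurable_wamp _ _ mH (Z := X : seq bool -> others _ _ _ -> R)) => j ju.
  by apply: measurable_others_prefix => //; rewrite size_rcons su.
have vneq e : size e = k -> v != e.
  by move=> ek; apply/eqP => /(congr1 size); rewrite size_rcons ek su; lia.
have mG : measurable_fun setT (fun w : others nonempty_words X v =>
    expR (\sum_(e <- s) term w e)).
  apply: (measurableT_comp (@measurable_expR R)).
  apply: measurable_sum_seq => -[u' i'] es.
  have su' : size u' = k by apply: (sk (u', i')); rewrite inE es orbT.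
  have mwu' : measurable_fun setT
      (fun w : others nonempty_words X v => wamp (val w) u' / 2).
    by apply: measurable_funM => //; apply: mw; [exact: vneq|rewrite su'].
  apply: measurable_funB; last exact: measurable_funM.
  apply: measurable_funM => //; apply: measurable_funM => //.
  apply: measurable_funB => //; apply: mw; last by rewrite size_rcons su'.
  apply: contraNneq us => /rcons_inj[-> ->]; exact: es.
have mF : measurable_fun setT F.
  apply/measurable_EFinP; apply: measurable_funM.
    exact: (measurableT_comp mG measurable_fst).
  apply: (measurableT_comp (@measurable_expR R)).
  have mwu : measurable_fun setT
      (fun z : others nonempty_words X v * R => wamp (val z.1) u / 2).
    apply: measurable_funM => //.
    have := mw u (vneq u su); rewrite su => /(_ (leqnSn k)) mu.
    exact: (measurableT_comp mu measurable_fst).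
  apply: measurable_funB; last exact: measurable_funM.
  apply: measurable_funM => //; apply: measurable_funM => //.
  apply: measurable_funB => //; apply: measurable_wamp_step => //.
    exact: (measurableT_comp (@mkamp u i) measurable_fst).
  exact: (measurableT_comp (@mslack u i) measurable_fst).
have F0 z : (0 <= F z)%E by rewrite lee_fin mulr_ge0 ?expR_ge0.
apply: le_trans (ih uniqs _); last by move=> e es; apply: sk; rewrite inE es orbT.
rewrite [leLHS](_ : _ = (\int[P]_w F (w, X v w))%E); last first.
  apply: eq_integral => w _.
  by rewrite big_cons addrC expRD /F /= wamp_rcons.
rewrite integral_one_step//; last exact: rcons_neq0.
apply: ge0_le_integral => //.
- by move=> w _; apply: integral_ge0.
- apply: (@measurable_others_le _ _ _ P _ nonempty_words X v).
  exact: (@measurable_fun_fubini_tonelli_F _ _ _ _ _ rho F mF F0).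
- apply/measurable_EFinP; exact: (@measurable_others_le _ _ _ P _ nonempty_words X v).
move=> w _; rewrite /F /=.
under eq_integral do rewrite EFinM.
rewrite ge0_integralZl_EFin ?expR_ge0//; last first.
  apply/measurable_EFinP; apply: (measurableT_comp (@measurable_expR R)).
  apply: measurable_funB => //; apply: measurable_funM => //.
  apply: measurable_funM => //; apply: measurable_funB => //.
  exact: measurable_wamp_step.
rewrite -[leRHS]mule1 lee_pmul2l// ?lte_fin ?expR_gt0//.
apply: exponential_moment => //.
- exact: measurable_wamp_step.
- move=> y; rewrite wamp_step_ge0 ?kamp_ge0//=.
  by have := wamp_step_le beta_gt0 L_ge1 H_le1 H_lt0 (val w) u y; rewrite su.
- by rewrite (Rintegral_wamp_step _ _ _ _ mH H_harm ipos).
Qed.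

Definition wsum (phi : seq bool -> R) (k : nat) (w : Omega) : R :=
  \sum_(u <- words k) wamp (val w) u * phi u.

Lemma measurable_wsum phi k : measurable_fun setT (wsum phi k).
Proof.
apply: measurable_sum_seq => u _; apply: measurable_funM => //.
by apply: (measurable_wamp _ _ mH (Z := X)) => j _; exact: mval.
Qed.

(** The means of a continuous function over the dyadic arcs satisfy this; it is what makes
    [wsum phi] a martingale. *)
Definition harmonic (phi : seq bool -> R) :=
  forall u, phi u = (phi (rcons u false) + phi (rcons u true)) / 2.

Let edges k := [seq (u, i) | u <- words k, i <- [:: false; true]].

Let wsum_increment phi k w : harmonic phi ->
  wsum phi k.+1 w - wsum phi k w = \sum_(e <- edges k)
    phi (rcons e.1 e.2) * (wamp (val w) (rcons e.1 e.2) - wamp (val w) e.1 / 2).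
Proof.
move=> hphi; rewrite /wsum big_words_recr big_allpairs_dep -sumrB.
apply: eq_bigr => u _; rewrite big_cons big_seq1 /= [phi u]hphi.
by field.
Qed.

Let edges_half k w : \sum_(e <- edges k) wamp (val w) e.1 / 2 = wsum (fun=> 1) k w.
Proof.
rewrite /wsum big_allpairs_dep; apply: eq_bigr => u _.
by rewrite big_cons big_seq1 /=; field.
Qed.

(** Exponential Chebyshev inequality. Each word of level k has two edges, so the compensator is 2
    lam^2 L beta^(k+1) times the truncated mass at level k; this is why the event includes a bound K
    on that mass. *)
Lemma wsum_increment_tail (phi : seq bool -> R) k (lam eps K : R) :
  harmonic phi -> (forall v, `|phi v| <= 1) ->
  0 <= lam -> lam * (L * beta ^+ k.+1) <= 1 / 2 ->
  (P [set w | (eps <= wsum phi k.+1 w - wsum phi k w)%R /\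
              (wsum (fun=> 1%R) k w <= K)%R] <=
   (expR (2 * lam ^+ 2 * (L * beta ^+ k.+1) * K - lam * eps))%:E)%E.
Proof.
move=> hphi phi1 lam0 lamb; set b := L * beta ^+ k.+1; set A := [set w | _].
have b0 : 0 <= b by rewrite mulr_ge0 ?exprn_ge0 ?(ltW beta_gt0)// (le_trans ler01).
have mA : measurable A.
  apply: measurableI.
    rewrite -[X in measurable X]setTI; apply: measurable_fun_le => //.
    by apply: measurable_funB; exact: measurable_wsum.
  rewrite -[X in measurable X]setTI; apply: measurable_fun_le => //.
  exact: measurable_wsum.
pose f w := expR (lam * (wsum phi k.+1 w - wsum phi k w) -
                  2 * lam ^+ 2 * b * wsum (fun=> 1) k w).
have mf : measurable_fun setT f.
  apply: (measurableT_comp (@measurable_expR R)); apply: measurable_funB.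
    by apply: measurable_funM => //; apply: measurable_funB; exact: measurable_wsum.
  by apply: measurable_funM => //; exact: measurable_wsum.
have f1 : (\int[P]_w (f w)%:E <= 1)%E.
  apply: le_trans (@exponential_increment k lam phi (edges k) lam0 lamb phi1 _ _).
  - apply: ge0_le_integral => //.
    + by move=> w _; rewrite lee_fin expR_ge0.
    + exact/measurable_EFinP.
    + apply/measurable_EFinP; apply: (measurableT_comp (@measurable_expR R)).
      apply: measurable_sum_seq => e _.
      have mwp u : measurable_fun setT (fun w => wamp (val w) u).
        by apply: (measurable_wamp _ _ mH (Z := X)) => j _; exact: mval.
      apply: measurable_funB; apply: measurable_funM => //.
        by apply: measurable_funM => //; apply: measurable_funB => //; exact: measurable_funM.
      exact: measurable_funM.
    + move=> w _; rewrite lee_fin /f wsum_increment// -edges_half.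
      by rewrite !mulr_sumr -sumrB.
  - by apply: allpairs_uniq => //; [exact: uniq_words|move=> [? ?] [? ?]].
  - by move=> _ /allpairsP[[u i] [/= uk _ ->]]; exact: size_words.
set c := expR (lam * eps - 2 * lam ^+ 2 * b * K).
have cA : (c%:E * P A <= 1)%E.
  apply: le_trans f1; rewrite -(setIT A) -integral_indic//.
  rewrite -ge0_integralZl_EFin ?expR_ge0//; last first.
    exact/measurable_EFinP.
  apply: ge0_le_integral => //.
  - by move=> w _; rewrite -EFinM lee_fin mulr_ge0 ?expR_ge0.
  - by apply/measurable_EFinP; apply: measurable_funM.
  - exact/measurable_EFinP.
  - move=> w _; rewrite -EFinM lee_fin indicE.
    have [wA|_] := boolP (w \in A); last by rewrite mulr0 expR_ge0.
    rewrite mulr1 ler_expR; move: wA; rewrite inE => -[w1 w2].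
    apply: lerB; first by rewrite ler_wpM2l.
    by rewrite ler_wpM2l// mulr_ge0// mulr_ge0// sqr_ge0.
have -> : expR (2 * lam ^+ 2 * b * K - lam * eps) = c^-1.
  by rewrite -expRN opprB.
have c0 : 0 < c := expR_gt0 _.
by rewrite -[leRHS]mule1 lee_pdivlMl.
Qed.

End random_cascade.

(** * Union bound, Borel-Cantelli, Markov, and superexponential tails *)

Section subadditivity.
Context d (T : measurableType d) (R : realType) (P : {measure set T -> \bar R}).

Lemma measure_bigsetU_le (I : eqType) (s : seq I) (A : I -> set T) (a : R) :
  (forall i, i \in s -> measurable (A i)) ->
  (forall i, i \in s -> P (A i) <= a%:E)%E ->
  measurable (\big[setU/set0]_(i <- s) A i) /\
  (P (\big[setU/set0]_(i <- s) A i) <= ((size s)%:R * a)%:E)%E.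
Proof.
elim: s => [_ _|i s ih mA PA].
  by rewrite big_nil measure0 mul0r; split.
have [||m1 p1] := ih.
- by move=> j js; apply: mA; rewrite inE js orbT.
- by move=> j js; apply: PA; rewrite inE js orbT.
have mi : measurable (A i) by apply: mA; rewrite mem_head.
rewrite big_cons; split; first exact: measurableU.
apply: le_trans (measureU2 _ mi m1) _.
by rewrite /= -natr1 mulrDl mul1r addrC EFinD leeD// PA// mem_head.
Qed.

Lemma borel_cantelli_geometric (A : nat -> set T) (C : R) :
  (forall k, measurable (A k)) ->
  (forall k, P (A k) <= (C / (2 ^ k.+1)%:R)%:E)%E ->
  {ae P, forall w, exists k0, forall k, (k0 <= k)%N -> ~ A k w}.
Proof.
move=> mA PA.
have C0 : 0 <= C.
  have := le_trans (measure_ge0 _ _) (PA 0%N).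
  by rewrite lee_fin pmulr_lge0// invr_gt0.
have L0 : P (lim_sup_set A) = 0%E.
  apply: lim_sup_set_cvg0 => //.
  apply: le_lt_trans (ltry C).
  apply: le_trans (epsilon_trick0 xpredT C0).
  by apply: lee_nneseries => // k _; exact: PA.
exists (lim_sup_set A); split => //.
- apply: bigcap_measurable => // k _.
  by apply: bigcup_measurable => j _.
- move=> w /= nw k0 _; apply: contrapT => nA; apply: nw; exists k0 => k kk Ak.
  by apply: nA; exists k.
Qed.

Lemma markov_ge0 (f : T -> R) (e : R) :
  measurable_fun setT f -> (forall x, 0 <= f x) -> 0 < e ->
  measurable [set x | e <= f x] /\
  (e%:E * P [set x | e <= f x]%R <= \int[P]_x (f x)%:E)%E.
Proof.
move=> mf f0 e0; set A := [set x | _]%R.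
have mA : measurable A.
  by rewrite -[X in measurable X]setTI; exact: measurable_fun_le.
split => //.
rewrite -(setIT A) -integral_indic// -ge0_integralZl_EFin ?(ltW e0)//; last first.
  exact/measurable_EFinP.
apply: ge0_le_integral => //.
- by move=> x _; rewrite -EFinM lee_fin mulr_ge0// ltW.
- by apply/measurable_EFinP; exact: measurable_funM.
- exact/measurable_EFinP.
- move=> x _; rewrite -EFinM lee_fin indicE.
  have [xA|_] := boolP (x \in A); last by rewrite mulr0.
  by rewrite mulr1; move: xA; rewrite inE.
Qed.

End subadditivity.

Lemma exists_expr_ge (R : realType) (a q : R) : 1 < q -> exists N, a <= q ^+ N.
Proof.
move=> q1; have q0 : 0 < q by rewrite (lt_trans ltr01).
have [N hN] : exists N : nat, a / (q - 1) <= N%:R.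
  exists (Num.Def.archi_bound `|a / (q - 1)|).
  by rewrite (le_trans (ler_norm _))// ltW// archi_boundP.
exists N; rewrite ler_pdivrMr ?subr_gt0// in hN; apply: le_trans hN _.
(* Bernoulli's inequality. *)
suff : 1 + N%:R * (q - 1) <= q ^+ N by lra.
elim: N => [|N ih]; first by rewrite mul0r addr0 expr0.
rewrite exprS -natr1.
have : q * (1 + N%:R * (q - 1)) <= q * q ^+ N by rewrite ler_pM2l.
have : 0 <= N%:R * (q - 1) ^+ 2 by rewrite mulr_ge0// sqr_ge0.
nra.
Qed.

(** exp x >= (x / (N + 1))^(N+1), so the exponential of q^(k+1) / a dominates every fixed power of
    q^(k+1). The power N + 1 is taken so large that q^(N+1) >= 2 M, which absorbs both M^k and
    2^(k+1). *)
Lemma geometric_tail (R : realType) (q a K : R) (c M : nat) :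
  1 < q -> 0 < a -> (0 < M)%N ->
  exists C : R, forall k : nat,
    (c * M ^ k)%N%:R * (2 * expR (K - q ^+ k.+1 / a)) <= C / (2 ^ k.+1)%:R.
Proof.
move=> q1 a0 M0.
have q0 : 0 < q by rewrite (lt_trans ltr01).
have [N hN] := exists_expr_ge (2 * M)%:R q1.
pose D := (a * N.+1%:R) ^+ N.+1.
exists (c%:R * 2 * expR K * D) => k.
set x := q ^+ k.+1 / a.
have x0 : 0 < x by rewrite divr_gt0// exprn_gt0.
have N0 : N.+1%:R != 0 :> R by rewrite pnatr_eq0.
have Mk0 : 0 < (M ^ k)%:R :> R by rewrite ltr0n expn_gt0 M0.
have T0 : 0 < (2 ^ k.+1)%:R :> R by rewrite ltr0n expn_gt0.
have D0 : 0 < D by rewrite exprn_gt0// mulr_gt0.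
have key : (2 ^ k.+1)%:R * (M ^ k)%:R <= D * expR x.
  apply: (@le_trans _ _ ((q ^+ N.+1) ^+ k.+1)).
    apply: (@le_trans _ _ ((2 * M)%:R ^+ k.+1)).
      rewrite -natrX expnMn -natrM ler_nat leq_mul2l (expnS M) leq_pmull ?orbT//.
    rewrite lerXn2r ?nnegrE ?exprn_ge0 ?(ltW q0)//.
    by rewrite (le_trans hN)// exprS ler_peMl ?exprn_ge0 ?(ltW q0)// ltW.
  have -> : expR x = expR (x / N.+1%:R) ^+ N.+1.
    by rewrite -expRM_natl mulrC divfK.
  rewrite /D -exprMn exprAC lerXn2r ?nnegrE ?exprn_ge0 ?(ltW q0)//.
    by rewrite mulr_ge0 ?expR_ge0// mulr_ge0// ltW.
  have : 1 + x / N.+1%:R <= expR (x / N.+1%:R) by exact: expR_ge1Dx.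
  have -> : q ^+ k.+1 = a * N.+1%:R * (x / N.+1%:R).
    by rewrite -mulrA (mulrC N.+1%:R) divfK// /x mulrC divfK// gt_eqF.
  move=> h; rewrite ler_wpM2l//; first by rewrite mulr_ge0// ltW.
  by apply: le_trans h; rewrite lerDr.
rewrite expRD expRN ler_pdivlMr// natrM.
have -> : c%:R * (M ^ k)%:R * (2 * (expR K * (expR x)^-1)) * (2 ^ k.+1)%:R =
  (c%:R * 2 * expR K) * (((2 ^ k.+1)%:R * (M ^ k)%:R) / expR x) by ring.
rewrite ler_wpM2l ?mulr_ge0 ?expR_ge0//.
by rewrite ler_pdivrMr ?expR_gt0.
Qed.

(** * Almost sure bounds uniform in the frequency *)

Section almost_sure.
Context (R : realType) d (Omega : measurableType d) (P : probability Omega R)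
  (X : seq bool -> {RV P >-> R}) (rho : probability R R).
Hypotheses (indep : mutually_independent nonempty_words X)
  (law : forall u, nonempty_words u -> forall B, measurable B ->
     distribution P (X u) B = rho B).
Variables (q : R) (H : R -> R).
Hypothesis q1 : 1 < q.
(** The fourth power leaves room between the amplitude bound L q^(-4k) and the tolerated increment
    q^-k, which need only be summable. *)
Let beta := (q ^+ 4)^-1.
Hypotheses
  (H_ge0 : forall x, 0 <= H x) (H_le1 : forall x, H x <= 1)
  (H_lt0 : forall x, x < 0 -> H x = 0) (H_nd : nondecreasing_fun H)
  (H_to1 : forall e, 0 < e -> exists x, 1 - e < H x)
  (ipos : rho.-integrable setT (EFin \o @pos_part R))
  (pos1 : \int[rho]_y pos_part y = 1)
  (H_harm : forall x, 0 <= x ->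
     H x = \int[rho]_y (pos_part y * H (x - ln (pos_part y / (2 * beta))))).

Let mH : measurable_fun setT H.
Proof. exact: nondecreasing_measurable. Qed.

Let q0 : 0 < q. Proof. exact: lt_trans q1. Qed.

Let beta_gt0 : 0 < beta. Proof. by rewrite invr_gt0 exprn_gt0. Qed.

Local Notation ws L := (wsum X beta L H).
Local Notation one := (fun=> 1%R).

Definition cascade_sum (phi : seq bool -> R) (k : nat) (w : Omega) : R :=
  \sum_(u <- words k) amp (X ^~ w) u * phi u.

Variables (I : choiceType) (Phi : I -> seq bool -> R) (J : nat -> seq I) (c M : nat).
Hypotheses (Phi_harmonic : forall i, harmonic (Phi i))
  (Phi_le1 : forall i v, `|Phi i v| <= 1) (M_gt0 : (0 < M)%N)
  (size_J : forall k, (size (J k) <= c * M ^ k)%N).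

Lemma wsum_increments_small (L K : R) : 1 <= L ->
  {ae P, forall w, exists k0, forall k, (k0 <= k)%N -> forall i, i \in J k ->
    ws L one k w <= K ->
    `|ws L (Phi i) k.+1 w - ws L (Phi i) k w| < q ^- k.+1}.
Proof.
move=> L1; have L0 : 0 < L := lt_le_trans ltr01 L1.
pose A1 k (phi : seq bool -> R) := [set w |
  q ^- k.+1 <= ws L phi k.+1 w - ws L phi k w /\ ws L one k w <= K].
pose A k := \big[setU/set0]_(i <- J k) (A1 k (Phi i) `|` A1 k (fun u => - Phi i u)).
have mA1 k phi : measurable (A1 k phi).
  apply: measurableI.
    rewrite -[X in measurable X]setTI; apply: measurable_fun_le => //.
    by apply: measurable_funB; exact: measurable_wsum.
  rewrite -[X in measurable X]setTI; apply: measurable_fun_le => //.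
  exact: measurable_wsum.
pose tau k : R := expR (K / (2 * L) - q ^+ k.+1 / (2 * L)).
have PA1 k phi : harmonic phi -> (forall v, `|phi v| <= 1) ->
    (P (A1 k phi) <= (tau k)%:E)%E.
  move=> hphi phi1.
  (* lam^2 * L * beta^(k+1) stays bounded, while lam * q^-(k+1) still grows. *)
  pose lam := q ^+ (2 * k.+1) / (2 * L).
  have lam0 : 0 <= lam by rewrite divr_ge0 ?exprn_ge0 ?(ltW q0)// mulr_ge0// ltW.
  have bE : beta ^+ k.+1 = (q ^+ k.+1) ^- 4.
    by rewrite /beta exprVn -!exprM mulnC.
  have qk0 : q ^+ k.+1 != 0 by rewrite gt_eqF// exprn_gt0.
  have qk1 : 1 <= q ^+ k.+1 by rewrite exprn_ege1// ltW.
  have lE : lam = (q ^+ k.+1) ^+ 2 / (2 * L) by rewrite /lam mulnC exprM.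
  have := @wsum_increment_tail _ _ _ _ _ _ indep law _ _ _
    beta_gt0 L1 H_ge0 H_le1 H_lt0 mH ipos H_harm _ k _ (q ^- k.+1) K hphi phi1 lam0.
  rewrite bE lE.
  set z := q ^+ k.+1 in qk0 qk1 *.
  have -> : z ^+ 2 / (2 * L) * (L * z ^- 4) = z ^- 2 / 2.
    by field; rewrite qk0 gt_eqF.
  have z2 : z ^- 2 / 2 <= 1 / 2.
    have z1 : 1 <= z ^+ 2 by nra.
    by rewrite ler_pM2r// invf_le1// (lt_le_trans ltr01).
  move=> /(_ z2) /le_trans; apply.
  rewrite lee_fin /tau -/z ler_expR le_eqVlt; apply/orP; left; apply/eqP.
  by field; rewrite qk0 gt_eqF.
have PU k i : (P (A1 k (Phi i) `|` A1 k (fun u => - Phi i u)%R) <= (2 * tau k)%:E)%E.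
  apply: le_trans (measureU2 _ (mA1 _ _) (mA1 _ _)) _.
  have -> : 2 * tau k = tau k + tau k by ring.
  rewrite EFinD leeD//; apply: PA1 => //; first by move=> u; rewrite Phi_harmonic; field.
  by move=> v; rewrite normrN.
have [C hC] := geometric_tail (K / (2 * L)) c q1 (mulr_gt0 (ltr0Sn R 1) L0) M_gt0.
have mA k : measurable (A k) /\ (P (A k) <= ((size (J k))%:R * (2 * tau k))%:E)%E.
  by apply: measure_bigsetU_le => i _; [exact: measurableU|exact: PU].
have : {ae P, forall w, exists k0, forall k, (k0 <= k)%N -> ~ A k w}.
  apply: (@borel_cantelli_geometric _ _ _ P A C) => k; first exact: (mA k).1.
  apply: le_trans (mA k).2 _; rewrite lee_fin; apply: le_trans (hC k).
  by rewrite ler_wpM2r ?ler_nat// mulr_ge0// expR_ge0.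
apply: filterS => w [k0 hk0]; exists k0 => k kk i iJ wK.
have nA := hk0 _ kk; rewrite ltNge; apply/negP => big_inc; apply: nA.
rewrite /A -bigcup_seq; exists i => //.
have [s|s] := lerP 0 (ws L (Phi i) k.+1 w - ws L (Phi i) k w).
  by left; split => //; rewrite ger0_norm in big_inc.
right; split => //; rewrite ltr0_norm// opprB in big_inc.
have wN j : ws L (fun u => - Phi i u) j w = - ws L (Phi i) j w.
  by rewrite /wsum -sumrN; apply: eq_bigr => u _; rewrite mulrN.
by rewrite !wN opprK addrC.
Qed.

Let size_words_list k : size (words k) = (2 ^ k)%N.
Proof. by elim: k => [//|k ih]; rewrite size_allpairs ih expnS mulnC. Qed.

Let L_ge1 (n : nat) : 1 <= expR n%:R :> R.
Proof. by rewrite -[leLHS]expR0 ler_expR. Qed.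

Let mmsum phi k : measurable_fun setT (cascade_sum phi k).
Proof.
apply: measurable_sum_seq => u _; apply: measurable_funM => //.
by apply: (measurable_amp (Z := X)) => j _; exact: measurable_funPT.
Qed.

Let mws L phi k : measurable_fun setT (ws L phi k).
Proof. exact: measurable_wsum. Qed.

Let sum_halves k (a : R) : (\sum_(u <- words k) (2 ^- size u * a)%:E = a%:E)%E.
Proof.
rewrite big_seq (eq_bigr (fun=> (2 ^- k * a)%:E)) => [|u /size_words -> //].
rewrite -big_seq sumEFin big_const_seq count_predT iter_addr addr0 size_words_list.
by rewrite -[_ *+ (2 ^ k)]mulr_natl natrX mulrA mulfV ?mul1r// expf_neq0.
Qed.

(** The mass removed up to level k together with the conditional mean of the mass still to be
    removed. *)
Let loss L k (w : Omega) : R := cascade_sum one k w - ws L one k w.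

Let loss_ge0 L k w : 1 <= L -> 0 <= loss L k w.
Proof.
move=> L1; rewrite /loss /cascade_sum /wsum -sumrB sumr_ge0// => u _.
by rewrite !mulr1 subr_ge0 wamp_amp.
Qed.

Let integral_loss L k : 1 <= L ->
  (\int[P]_w (loss L k w)%:E = (1 - H (ln L))%:E)%E.
Proof.
move=> L1.
have Em : (\int[P]_w (cascade_sum one k w)%:E = 1)%E.
  under eq_integral do rewrite /cascade_sum -sumEFin.
  rewrite ge0_integral_sum//; last 2 first.
  - move=> u; apply/measurable_EFinP; apply: measurable_funM => //.
    by apply: (measurable_amp (Z := X)) => j _; exact: measurable_funPT.
  - by move=> u w _; rewrite lee_fin mulr1 amp_ge0.
  rewrite -[RHS](sum_halves k); apply: eq_bigr => u _; rewrite mulr1.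
  under eq_integral do rewrite mulr1.
  exact: (integral_amp indep law beta_gt0 L1 ipos pos1).
have Ew : (\int[P]_w (ws L one k w)%:E = (H (ln L))%:E)%E.
  under eq_integral do rewrite /wsum -sumEFin.
  rewrite ge0_integral_sum//; last 2 first.
  - move=> u; apply/measurable_EFinP; apply: measurable_funM => //.
    by apply: (measurable_wamp _ _ mH (Z := X)) => j _; exact: measurable_funPT.
  - by move=> u w _; rewrite lee_fin mulr1 wamp_ge0.
  rewrite -[RHS](sum_halves k); apply: eq_bigr => u _.
  under eq_integral do rewrite mulr1.
  exact: (integral_wamp indep law beta_gt0 L1 H_ge0 H_le1 H_lt0 mH ipos H_harm).
have : (\int[P]_w (loss L k w)%:E + \int[P]_w (ws L one k w)%:E = 1)%E.
  rewrite -ge0_integralD//; first last.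
  - exact/measurable_EFinP.
  - move=> w _; rewrite lee_fin sumr_ge0// => u _.
    by rewrite mulr1 wamp_ge0.
  - by apply/measurable_EFinP; exact: measurable_funB.
  - by move=> w _; rewrite lee_fin loss_ge0.
  by rewrite -Em; apply: eq_integral => w _; rewrite -EFinD /loss subrK.
by rewrite Ew => h; rewrite EFinB -h addeK.
Qed.

(** With L = exp n the loss has mean 1 - H n at every level, and Markov's inequality bounds its size
    at one level at a time. By continuity from below, the event [G n] that it stays large from some
    level on has the same bound, which tends to 0 with n. The conclusion thus holds along infinitely
    many levels only, which suffices for sums known to converge. *)
Let loss_small : {ae P, forall w (j : nat), exists n : nat, forall m : nat,
  exists2 k, (m <= k)%N & loss (expR n%:R) k w < j.+1%:R^-1}.
Proof.
apply: ae_foralln => j.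
have e0 : 0 < j.+1%:R^-1 :> R by rewrite invr_gt0.
pose B n k := [set w | (j.+1%:R^-1 <= loss (expR n%:R) k w)%R].
have PB n k : measurable (B n k) /\
    (P (B n k) <= (j.+1%:R * (1 - H n%:R))%:E)%E.
  have mloss : measurable_fun setT (loss (expR n%:R) k) by exact: measurable_funB.
  have [mB pB] := markov_ge0 P mloss (fun w => loss_ge0 k w (L_ge1 n)) e0.
  split => //; move: pB; rewrite integral_loss// expRK => pB.
  by rewrite -[j.+1%:R]invrK EFinM lee_pdivlMl.
pose F n m := \bigcap_(k >= m) B n k.
have mF n m : measurable (F n m).
  by apply: bigcap_measurable => [|k _]; [exists m => /=|exact: (PB n k).1].
pose G n := \bigcup_m F n m.
have mG n : measurable (G n) by apply: bigcup_measurable => m _.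
have PG n : (P (G n) <= (j.+1%:R * (1 - H n%:R))%:E)%E.
  have cF : P \o F n @ \oo --> P (G n).
    apply: nondecreasing_cvg_mu => //; first exact: mG.
    move=> a b ab; apply/subsetPset => w Fw k /= bk; apply: Fw => /=.
    exact: leq_trans bk.
  rewrite -(cvg_lim _ cF)//; apply: lime_le; first by apply/cvg_ex; eexists; exact: cF.
  apply: nearW => m; apply: le_trans (PB n m).2.
  apply: le_measure; rewrite ?inE//; first exact: (PB n m).1.
  by move=> w; apply => /=.
exists (\bigcap_n G n); split.
- by apply: bigcap_measurable => // n _.
- apply/eqP; rewrite eq_le measure_ge0 andbT; apply/lee_addgt0Pr => e e0'.
  rewrite add0e; have [x hx] := H_to1 (divr_gt0 e0' (ltr0Sn R j)).
  pose n := Num.Def.archi_bound `|x|.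
  have xn : x <= n%:R.
    by rewrite (le_trans (ler_norm x))// ltW// archi_boundP.
  apply: (@le_trans _ _ (P (G n))).
    apply: le_measure; rewrite ?inE//; last by move=> w; apply.
    by apply: bigcap_measurable => // k _.
  apply: le_trans (PG n) _; rewrite lee_fin mulrC -ler_pdivlMr//.
  have := le_trans (ltW hx) (H_nd xn).
  by rewrite lerBlDr -lerBlDl.
- move=> w /= nw n _; apply: contrapT => nG; apply: nw; exists n => m.
  apply: contrapT => nk; apply: nG; exists m => // k /= mk.
  by rewrite /B /= leNgt; apply/negP => lk; apply: nk; exists k.
Qed.

(** Three errors: the truncated sum at level n is at most eta K, the later increments sum to at most
    e / 2, and the truncation loss is at most e / 2 along infinitely many levels. The threshold [n1]
    is independent of the index i, which gives uniformity in the frequency. *)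
Lemma cascade_limit_bound :
  {ae P, forall w (K : R), (forall k, cascade_sum one k w <= K) ->
    forall e : R, 0 < e -> exists n1 : nat, forall n, (n1 <= n)%N ->
    forall i (eta : R), (forall k, (n <= k)%N -> i \in J k) ->
      (forall u, size u = n -> `|Phi i u| <= eta) ->
    forall m, exists2 k, (m <= k)%N & `|cascade_sum (Phi i) k w| <= eta * K + e}.
Proof.
(* The mass bound and the truncation level depend on w, so a single null set is obtained by letting
   both range over countable sets. *)
have small : {ae P, forall w (n K : nat), exists k0, forall k, (k0 <= k)%N ->
    forall i, i \in J k -> ws (expR n%:R) one k w <= K%:R ->
    `|ws (expR n%:R) (Phi i) k.+1 w - ws (expR n%:R) (Phi i) k w| < q ^- k.+1}.
  apply: ae_foralln => n; apply: ae_foralln => K.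
  exact: wsum_increments_small.
move: small loss_small; apply: filterS2 => w small lost K wK e e0.
have e20 : 0 < e / 2 by rewrite divr_gt0.
pose j := Num.Def.archi_bound (e / 2)^-1.
have je : j.+1%:R^-1 <= e / 2.
  rewrite invf_ple ?posrE//; apply: le_trans (_ : j%:R <= _); last by rewrite ler_nat.
  by apply: ltW; apply: archi_boundP; rewrite invr_ge0 ltW.
have [nL lostL] := lost j; pose L : R := expR nL%:R.
pose K' := Num.Def.archi_bound `|K|.
have KK' : K <= K'%:R by rewrite (le_trans (ler_norm K))// ltW// archi_boundP.
have [k0 incr] := small nL K'.
have wsK k : ws L one k w <= K.
  by apply: le_trans (wK k); rewrite -subr_ge0; exact: (loss_ge0 k w (L_ge1 nL)).
have [k1 tail] : exists k1 : nat, forall n m, (k1 <= n)%N ->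
    \sum_(n <= k < m) q ^- k.+1 <= e / 2.
  have [k1 hk1] := exists_expr_ge ((q - 1) * (e / 2))^-1 q1.
  exists k1 => n m kn; have qn : ((q - 1) * (e / 2))^-1 <= q ^+ n.
    by apply: le_trans hk1 _; rewrite ler_eXn2l.
  have [nm|mn] := leqP n m; last by rewrite big_geq ?(ltnW mn)// ltW.
  have -> : \sum_(n <= k < m) q ^- k.+1 = (q ^- n - q ^- m) / (q - 1).
    rewrite -opprB -(telescope_sumr (fun k => q ^- k) nm) -sumrN mulr_suml.
    apply: eq_bigr => k _; rewrite exprS; field.
    by rewrite !gt_eqF ?subr_gt0 ?exprn_gt0.
  rewrite ler_pdivrMr ?subr_gt0// mulrC.
  apply: (@le_trans _ _ (q ^- n)); first by rewrite gerBl invr_ge0 exprn_ge0// ltW.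
  by rewrite invf_ple ?posrE ?exprn_gt0 ?mulr_gt0 ?subr_gt0.
exists (maxn k0 k1) => n; rewrite geq_max => /andP[kn0 kn1] i eta iJ eta_le m.
have [k nk loss_k] := lostL (maxn m n).
move: nk; rewrite geq_max => /andP[mk nk].
exists k => //.
have start : `|ws L (Phi i) n w| <= eta * K.
  apply: (@le_trans _ _ (\sum_(u <- words n) wamp beta L H (X ^~ w) u * eta)).
    rewrite /wsum; apply: le_trans (ler_norm_sum _ _ _) _.
    rewrite big_seq [leRHS]big_seq; apply: ler_sum => u /size_words su.
    by rewrite normrM ger0_norm ?wamp_ge0// ler_wpM2l ?wamp_ge0// eta_le.
  rewrite -mulr_suml mulrC ler_wpM2l//.
    by apply: le_trans (eta_le (nseq n true) (size_nseq _ _)).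
  by apply: le_trans (wsK n); rewrite /wsum; under [leRHS]eq_bigr do rewrite mulr1.
have path : `|ws L (Phi i) k w - ws L (Phi i) n w| <= \sum_(n <= l < k) q ^- l.+1.
  rewrite -(telescope_sumr (fun l => ws L (Phi i) l w) nk).
  apply: le_trans (ler_norm_sum _ _ _) _.
  rewrite big_nat_cond [leRHS]big_nat_cond; apply: ler_sum => l /andP[/andP[nl lk] _].
  apply: ltW; apply: incr; [exact: leq_trans nl|exact: iJ|].
  exact: le_trans (wsK l) KK'.
have lossb : `|cascade_sum (Phi i) k w - ws L (Phi i) k w| <= loss L k w.
  rewrite /loss /cascade_sum /wsum -!sumrB; apply: le_trans (ler_norm_sum _ _ _) _.
  apply: ler_sum => u _; rewrite !mulr1 -mulrBl normrM ger0_norm; last first.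
    by rewrite subr_ge0 wamp_amp// L_ge1.
  by rewrite ler_piMr// subr_ge0 wamp_amp// L_ge1.
have := tail n k kn1.
have -> : cascade_sum (Phi i) k w = (cascade_sum (Phi i) k w - ws L (Phi i) k w) +
  (ws L (Phi i) k w - ws L (Phi i) n w) + ws L (Phi i) n w by ring.
move=> tl; apply: le_trans (ler_normD _ _) _.
rewrite addrC lerD//; apply: le_trans (ler_normD _ _) _.
apply: le_trans (lerD (le_trans lossb (ltW loss_k)) (le_trans path tl)) _.
by rewrite [leRHS]splitr lerD2r.
Qed.

End almost_sure.

(** * Integrals of continuous functions over segments *)

Section integral_on_segments.
Context (R : realType).
Notation mu := (@lebesgue_measure R).

Lemma continuous_itv_integrable (g : R -> R) a b : continuous g ->
  mu.-integrable `[a, b] (EFin \o g).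
Proof.
move=> cg; apply: continuous_compact_integrable; first exact: segment_compact.
exact: (continuous_subspaceT cg).
Qed.

Lemma Rintegral_itv_le (g : R -> R) a b C : a <= b ->
  mu.-integrable `[a, b] (EFin \o g) ->
  (forall t, a <= t <= b -> `|g t| <= C) ->
  `|\int[mu]_(t in `[a, b]) g t| <= C * (b - a).
Proof.
move=> ab ig gC; apply: le_trans (le_normr_Rintegral _ ig) _ => //.
have -> : C * (b - a) = \int[mu]_(t in `[a, b]) C.
  rewrite Rintegral_cst//= lebesgue_measure_itv/= lte_fin.
  by move: ab; rewrite le_eqVlt => /predU1P[->|->//]; rewrite ltxx subrr.
apply: le_Rintegral => //.
- exact: integrable_norm.
- apply: continuous_compact_integrable; first exact: segment_compact.
  by apply: continuous_subspaceT => t; exact: cvg_cst.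
Qed.

Lemma Rintegral_itv_split (g : R -> R) a c b : continuous g -> a <= c -> c <= b ->
  \int[mu]_(t in `[a, b]) g t =
  \int[mu]_(t in `[a, c]) g t + \int[mu]_(t in `[c, b]) g t.
Proof.
move=> cg ac cb; rewrite -(@Rintegral_itv_obnd_cbnd _ c); last first.
  apply: (integrableS _ _ _ (continuous_itv_integrable c b cg)) => //.
  by move=> t /=; rewrite !in_itv/= => /andP[/ltW -> ->].
have /= := @Rintegral_itvB _ g (BLeft a) (BRight b) c (continuous_itv_integrable a b cg).
rewrite !bnd_simp => /(_ ac cb) <-.
by rewrite addrC subrK.
Qed.

End integral_on_segments.

(** * Oscillatory integrals along the curve *)

Section van_der_corput.
Context (R : realType).
Notation mu := (@lebesgue_measure R).
Variables (f f1 f2 : R -> R).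
Hypotheses (df : forall t : R, is_derive t 1 f (f1 t))
  (df1 : forall t : R, is_derive t 1 f1 (f2 t)) (cf2 : continuous f2).

Let continuous_derive (g g' : R -> R) : (forall t : R, is_derive t 1 g (g' t)) ->
  continuous g.
Proof.
by move=> dg t; apply/differentiable_continuous/derivable1_diffP; case: (dg t).
Qed.

Let cf : continuous f. Proof. exact: continuous_derive df. Qed.
Let cf1 : continuous f1. Proof. exact: continuous_derive df1. Qed.

Let osc (a b : R) : R := \int[mu]_(t in `[a, b]) cos (f t).

Let ccos : continuous (fun t => cos (f t)).
Proof. by move=> t; apply: (@continuous_comp _ _ _ f cos); [exact: cf|exact: continuous_cos]. Qed.

Let icos a b : mu.-integrable `[a, b] (EFin \o (fun t => cos (f t))).
Proof. exact: (continuous_itv_integrable _ _ ccos). Qed.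

Let osc_split a c b : a <= c -> c <= b -> osc a b = osc a c + osc c b.
Proof. exact: (Rintegral_itv_split ccos). Qed.

Let osc_le a b : a <= b -> `|osc a b| <= b - a.
Proof.
move=> ab; rewrite -[leRHS]mul1r; apply: Rintegral_itv_le => // t _.
by rewrite ler_norml cos_geN1 cos_le1.
Qed.

(* Integration by parts: cos f = (sin f / f')' + sin f f'' / f'^2.            *)
Let osc_nonstationary a b eta K : a <= b -> 0 < eta ->
  (forall t, a <= t <= b -> eta <= `|f1 t|) ->
  (forall t, a <= t <= b -> `|f2 t| <= K) ->
  `|osc a b| <= 2 / eta + K * (b - a) / eta ^+ 2.
Proof.
rewrite le_eqVlt => /predU1P[<-{b}|ab] eta0 lf1 uf2.
  have := osc_le (lexx a); rewrite subrr normr_le0 => /eqP ->.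
  by rewrite normr0 mulr0 mul0r addr0 divr_ge0// ltW.
have f1n0 t : t \in `[a, b] -> f1 t != 0.
  rewrite in_itv/= => tab; rewrite -normr_gt0; exact: lt_le_trans (lf1 t tab).
pose E t := sin (f t) * f2 t / f1 t ^+ 2.
pose G t := cos (f t) - E t.
pose F t := sin (f t) * (f1 t)^-1.
have cE t : t \in `[a, b] -> {for t, continuous E}.
  move=> tab; apply: cvgM; first apply: cvgM.
  - by apply: (@continuous_comp _ _ _ f sin); [exact: cf|exact: continuous_sin].
  - exact: cf2.
  - apply: cvgV; first by rewrite expf_neq0// f1n0.
    by apply: (@continuous_comp _ _ _ f1 (fun x => x ^+ 2)); [exact: cf1|exact: exprn_continuous].
have iE : mu.-integrable `[a, b] (EFin \o E).
  apply: continuous_compact_integrable; first exact: segment_compact.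
  by apply: continuous_in_subspaceT => t; rewrite inE/=; exact: cE.
have cG : {within `[a, b], continuous G}.
  apply: continuous_in_subspaceT => t; rewrite inE/= => tab.
  by apply: cvgB; [exact: ccos|exact: cE].
have dF t : t \in `[a, b] -> is_derive t 1 F (G t).
  move=> tab.
  have h1 : is_derive t 1 (fun t => sin (f t)) (cos (f t) * f1 t).
    exact: (@is_derive1_comp _ sin f).
  have h2 := is_deriveV (f1n0 t tab) (df1 t).
  apply: is_derive_eq (is_deriveM h1 h2) _.
  rewrite /G /E /GRing.scale /=; field; exact: f1n0.
have FTC : \int[mu]_(t in `[a, b]) G t = F b - F a.
  rewrite /Rintegral (continuous_FTC2 (F := F) ab cG)//.
    split.
    + by move=> t tab; have [] := dF t (subset_itv_oo_cc tab).
    + apply: cvg_at_right_filter; apply/differentiable_continuous/derivable1_diffP.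
      by have [] := dF a; rewrite ?in_itv/= ?lexx ?ltW.
    + apply: cvg_at_left_filter; apply/differentiable_continuous/derivable1_diffP.
      by have [] := dF b; rewrite ?in_itv/= ?lexx ?ltW.
  by move=> t tab; have [_ ] := dF t (subset_itv_oo_cc tab); rewrite derive1E.
have -> : osc a b = F b - F a + \int[mu]_(t in `[a, b]) E t.
  rewrite -FTC -RintegralD//.
    by apply: eq_Rintegral => t _; rewrite /G subrK.
  by apply: continuous_compact_integrable; first exact: segment_compact.
have Fb t : a <= t <= b -> `|F t| <= eta^-1.
  move=> tab; rewrite normrM normfV -[leRHS]mul1r ler_pM//.
  - by rewrite ler_norml sin_geN1 sin_le1.
  - by rewrite lef_pV2 ?posrE ?lf1// (lt_le_trans eta0)// lf1.
apply: le_trans (ler_normD _ _) _; apply: lerD.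
  apply: le_trans (ler_normB _ _) _.
  have := Fb a; have := Fb b; rewrite !lexx (ltW ab) /= => /(_ isT) h1 /(_ isT) h2.
  by rewrite mulr_natl mulr2n lerD.
rewrite mulrAC; apply: Rintegral_itv_le => //; first exact: ltW.
move=> t tab; rewrite normrM normrM normfV -[K]mul1r.
apply: ler_pM => //.
  by apply: ler_pM => //; [rewrite ler_norml sin_geN1 sin_le1|exact: uf2].
rewrite lef_pV2 ?posrE ?exprn_gt0//; last first.
  by rewrite normr_gt0 expf_neq0// f1n0// in_itv.
by rewrite normrX lerXn2r ?nnegrE ?(ltW eta0) ?lf1.
Qed.

(** If |f'| < eta at some t0, the lower bound m on |f''| and the mean value theorem force |f'| >=
    eta at distance at least r = 2 eta / m from t0. The interval of radius r contributes at most 2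
    r, and the two sides are integrated by parts. *)
Let stationary_bound a b eta K m : a <= b -> 0 < eta -> 0 < m ->
  (forall t, a <= t <= b -> m <= `|f2 t| <= K) ->
  `|osc a b| <= 4 / eta + 2 * (K * (b - a) / eta ^+ 2) + 4 * eta / m.
Proof.
move=> ab eta0 m0 hf2.
have uf2 t : a <= t <= b -> `|f2 t| <= K by move=> /hf2/andP[].
have K0 : 0 <= K by apply: le_trans (uf2 a _); rewrite ?lexx.
have piece c e : a <= c -> c <= e -> e <= b ->
    (forall t, c <= t <= e -> eta <= `|f1 t|) ->
    `|osc c e| <= 2 / eta + K * (b - a) / eta ^+ 2.
  move=> ac ce eb h.
  apply: le_trans (osc_nonstationary ce eta0 h _) _.
    by move=> t /andP[ct te]; apply: uf2; rewrite (le_trans ac)// (le_trans te).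
  by rewrite lerD2l ler_pM2r ?invr_gt0 ?exprn_gt0// ler_wpM2l// lerB.
have N0 : 0 <= 2 / eta + K * (b - a) / eta ^+ 2.
  by rewrite addr_ge0// divr_ge0 ?mulr_ge0 ?subr_ge0 ?exprn_ge0 ?(ltW eta0).
have [[t0 [t0ab ft0]]|nt0] := pselect (exists t0, a <= t0 <= b /\ `|f1 t0| < eta); last first.
  have := piece a b (lexx _) ab (lexx _).
  have : 0 <= 4 * eta / m by rewrite divr_ge0 ?mulr_ge0// ltW.
  move=> h1 /(_ _)/le_trans; apply; last by lra.
  by move=> t tab; rewrite leNgt; apply/negP => h; apply: nt0; exists t.
pose r := 2 * eta / m.
have r0 : 0 < r by rewrite divr_gt0// mulr_gt0.
have far t : a <= t <= b -> r <= `|t - t0| -> eta <= `|f1 t|.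
  move=> tab rt.
  have mvt : m * `|t - t0| <= `|f1 t - f1 t0|.
    wlog : t t0 tab t0ab {ft0 rt} / t0 <= t.
      move=> wl; have [|/ltW] := leP t0 t; first exact: wl.
      by rewrite distrC (distrC (f1 t)); exact: wl.
    move=> tt; have [c] := @MVT_segment _ f1 f2 t0 t tt (fun x _ => df1 x)
       (continuous_subspaceT cf1).
    rewrite in_itv/= => /andP[tc ct] ->; rewrite normrM ler_wpM2r//.
    have /hf2/andP[] : a <= c <= b by case/andP: tab => _ tb; case/andP: t0ab => at0 _;
      rewrite (le_trans at0)// (le_trans ct).
    by [].
  have h2 : 2 * eta <= m * `|t - t0|.
    by rewrite -ler_pdivrMl// mulrC.
  have := ler_normB (f1 t) (f1 t0); lra.
have /andP[at0 t0b] := t0ab.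
pose l := Num.max a (t0 - r); pose u := Num.min b (t0 + r).
have al : a <= l by rewrite le_max lexx.
have lt : l <= t0 by rewrite ge_max at0 gerBl ltW.
have tu : t0 <= u by rewrite le_min t0b lerDl ltW.
have ub : u <= b by rewrite ge_min lexx.
rewrite (osc_split al (le_trans lt t0b)) (osc_split (le_trans lt tu) ub).
have B1 : `|osc a l| <= 2 / eta + K * (b - a) / eta ^+ 2.
  have [h|h] := leP (t0 - r) a.
    have -> : l = a by rewrite /l max_l.
    by apply: le_trans (osc_le (lexx a)) _; rewrite subrr.
  have lE : l = t0 - r by rewrite /l max_r// ltW.
  apply: piece => //; first exact: le_trans lt t0b.
  move=> t /andP[a_t tl]; apply: far; first by rewrite a_t (le_trans tl)// (le_trans lt).
  by rewrite distrC; apply: le_trans (ler_norm _); move: tl; rewrite lE; lra.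
have B3 : `|osc u b| <= 2 / eta + K * (b - a) / eta ^+ 2.
  have [h|h] := leP b (t0 + r).
    have -> : u = b by rewrite /u min_l.
    by apply: le_trans (osc_le (lexx b)) _; rewrite subrr.
  have uE : u = t0 + r by rewrite /u min_r// ltW.
  apply: piece => //; first exact: le_trans at0 tu.
  move=> t /andP[ut tb]; apply: far; first by rewrite tb (le_trans at0)// (le_trans tu).
  by apply: le_trans (ler_norm _); move: ut; rewrite uE; lra.
have B2 : `|osc l u| <= 2 * r.
  apply: le_trans (osc_le (le_trans lt tu)) _.
  have : t0 - r <= l by rewrite le_max lexx orbT.
  have : u <= t0 + r by rewrite ge_min lexx orbT.
  lra.
apply: le_trans (ler_normD _ _) _; rewrite addrC.
have := ler_normD (osc l u) (osc u b).
have -> : 4 * eta / m = 2 * r by rewrite /r; ring.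
have -> : 4 / eta = 2 * (2 / eta) by ring.
lra.
Qed.

(** With eta = lam / s every term of the stationary bound is O(s / lam + s^2 / lam + 1 / s), hence
    O(1 / s) when s^3 <= lam. The parameter s stands for a cube root of lam. *)
Lemma van_der_corput (a b C c lam s : R) :
  a <= b <= a + 1 -> 0 < c -> 0 <= C -> 1 <= s -> s ^+ 3 <= lam ->
  (forall t, a <= t <= b -> `|f2 t| <= C * lam) ->
  (forall t, a <= t <= b -> c * lam <= `|f1 t|) \/
    (forall t, a <= t <= b -> c * lam <= `|f2 t|) ->
  `|\int[mu]_(t in `[a, b]) cos (f t)| <=
    (4 + 2 * C + 4 / c + 2 / c + C / c ^+ 2) / s.
Proof.
move=> /andP[ab ba1] c0 C0 s1 slam uf2 alt; rewrite -/(osc a b).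
have s0 : 0 < s by exact: lt_le_trans s1.
have lam0 : 0 < lam by apply: lt_le_trans slam; rewrite exprn_gt0.
have ba : b - a <= 1 by lra.
have sE x : x / s = x * s^-1 by [].
have si0 : 0 < s^-1 by rewrite invr_gt0.
have ssl : s <= lam.
  apply: le_trans slam; rewrite exprS ler_peMr ?(ltW s0)// exprn_ege1//.
have lami : lam^-1 <= s^-1 by rewrite lef_pV2.
case: alt => [lf1|lf2].
  have cl0 : 0 < c * lam by rewrite mulr_gt0.
  apply: le_trans (osc_nonstationary ab cl0 lf1 uf2) _.
  have e1 : 2 / (c * lam) <= 2 / c / s.
    by rewrite invfM mulrA ler_wpM2l// divr_ge0// ltW.
  have e2 : C * lam * (b - a) / (c * lam) ^+ 2 <= C / c ^+ 2 / s.
    have -> : C * lam * (b - a) / (c * lam) ^+ 2 =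
       C / c ^+ 2 * ((b - a) * lam^-1) by field; rewrite !gt_eqF.
    rewrite ler_wpM2l ?divr_ge0 ?exprn_ge0 ?(ltW c0)//.
    by apply: le_trans lami; rewrite ler_piMl// invr_ge0 ltW.
  apply: le_trans (lerD e1 e2) _; rewrite -mulrDl ler_wpM2r ?(ltW si0)//.
  rewrite lerD2r lerDr addr_ge0 ?addr_ge0 ?mulr_ge0 ?invr_ge0 ?(ltW c0)//.
pose eta := lam / s.
have eta0 : 0 < eta by rewrite divr_gt0.
have cl0 : 0 < c * lam by rewrite mulr_gt0.
apply: le_trans (@stationary_bound a b eta (C * lam) (c * lam) ab eta0 cl0 _) _.
  by move=> t tab; rewrite lf2//= uf2.
have q1 : s ^+ 2 * lam^-1 <= s^-1.
  rewrite ler_pdivrMr// mulrC -[leLHS]mulr1 -(mulfV (lt0r_neq0 s0)) mulrA -exprSr.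
  by rewrite ler_wpM2r ?(ltW si0).
have e1 : 4 / eta <= 4 / s.
  rewrite /eta invf_div ler_pM2l//.
  apply: le_trans q1; rewrite ler_wpM2r ?invr_ge0 ?(ltW lam0)//.
  by rewrite expr2 ler_peMr// ltW.
have e2 : 2 * (C * lam * (b - a) / eta ^+ 2) <= 2 * C / s.
  have -> : C * lam * (b - a) / eta ^+ 2 = C * ((b - a) * (s ^+ 2 * lam^-1)).
    by rewrite /eta; field; rewrite !gt_eqF.
  rewrite -mulrA ler_pM2l// ler_wpM2l//; apply: le_trans q1.
  by rewrite ler_piMl// mulr_ge0 ?exprn_ge0 ?invr_ge0 ?ltW.
have e3 : 4 * eta / (c * lam) = 4 / c / s.
  by rewrite /eta; field; rewrite !gt_eqF.
rewrite e3; apply: le_trans (lerD (lerD e1 e2) (lexx _)) _.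
have -> : (4 + 2 * C + 4 / c + 2 / c + C / c ^+ 2) / s =
  4 / s + 2 * C / s + 4 / c / s + (2 / c + C / c ^+ 2) / s.
  by field; rewrite !gt_eqF.
by rewrite lerDl divr_ge0 ?addr_ge0 ?divr_ge0 ?exprn_ge0 ?(ltW c0) ?(ltW s0).
Qed.

End van_der_corput.

(** * Means over dyadic arcs *)

Section dyadic_averages.
Context (R : realType).
Notation mu := (@lebesgue_measure R).
Implicit Type u : seq bool.

Lemma left_endpoint_rcons u i :
  left_endpoint (rcons u i) = left_endpoint u + i%:R / 2 ^+ (size u).+1 :> R.
Proof.
rewrite /left_endpoint size_rcons big_ord_recr /= nth_rcons ltnn eqxx.
by congr (_ + _); apply: eq_bigr => j _; rewrite nth_rcons ltn_ord.
Qed.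

Lemma left_endpoint_itv u :
  0 <= left_endpoint u :> R /\ left_endpoint u + 2 ^- size u <= 1 :> R.
Proof.
elim/last_ind: u => [|u i [l0 l1]].
  by rewrite /left_endpoint big_ord0 expr0 invr1 add0r.
have p : 0 < 2 ^- (size u).+1 :> R by rewrite invr_gt0 exprn_gt0.
have pE : 2 ^- size u = 2 * 2 ^- (size u).+1 :> R.
  by rewrite exprS invfM mulrA mulfV ?mul1r.
rewrite left_endpoint_rcons size_rcons; split.
  by rewrite addr_ge0// mulr_ge0// ltW.
by move: l1; rewrite pE; case: i => /=; rewrite ?mul1r ?mul0r; lra.
Qed.

Definition dyadic_average (g : R -> R) u : R :=
  2 ^+ size u *
  \int[mu]_(t in `[left_endpoint u, left_endpoint u + 2 ^- size u]) g t.

Lemma dyadic_average_split g u : continuous g ->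
  dyadic_average g u =
  (dyadic_average g (rcons u false) + dyadic_average g (rcons u true)) / 2.
Proof.
move=> cg; rewrite /dyadic_average !left_endpoint_rcons !size_rcons /=.
set a := left_endpoint u; set p := 2 ^- (size u).+1.
have p0 : 0 < p by rewrite invr_gt0 exprn_gt0.
have -> : 2 ^- size u = p + p.
  by rewrite /p exprS invfM -mulr2n -[RHS]mulr_natl mulrA mulfV ?mul1r.
rewrite mul0r addr0 mul1r -/p.
rewrite (@Rintegral_itv_split _ g a (a + p))// ?lerDl ?lerD2l ?ltW//; last first.
  by rewrite ltrDl.
by rewrite exprS addrA; field.
Qed.

Lemma dyadic_average_le g u (C : R) : continuous g ->
  (forall t, `|g t| <= C) -> `|dyadic_average g u| <= C.
Proof.
move=> cg gC; rewrite normrM ger0_norm ?exprn_ge0//.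
rewrite -ler_pdivlMl ?exprn_gt0//.
have h : left_endpoint u <= left_endpoint u + 2 ^- size u :> R.
  by rewrite lerDl invr_ge0 exprn_ge0.
apply: le_trans (Rintegral_itv_le h (continuous_itv_integrable _ _ cg) _) _.
  by move=> t _; exact: gC.
by rewrite addrAC subrr add0r mulrC.
Qed.

End dyadic_averages.

(** * Linear phases along a curve with nonvanishing determinant *)

Section phase.
Context (R : realType).
Notation mu := (@lebesgue_measure R).
Variables (g0 g1 g2 : R -> R * R) (del : R).
Hypotheses
  (d01 : forall t : R, is_derive t 1 (fun s => (g0 s).1) (g1 t).1)
  (d02 : forall t : R, is_derive t 1 (fun s => (g0 s).2) (g1 t).2)
  (d11 : forall t : R, is_derive t 1 (fun s => (g1 s).1) (g2 t).1)
  (d12 : forall t : R, is_derive t 1 (fun s => (g1 s).2) (g2 t).2)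
  (c21 : continuous (fun t => (g2 t).1)) (c22 : continuous (fun t => (g2 t).2))
  (del0 : 0 < del) (hdel : forall t, del <= `|det2 (g1 t) (g2 t)|).

Let derive_continuous (g g' : R -> R) : (forall t : R, is_derive t 1 g (g' t)) ->
  continuous g.
Proof.
by move=> dg t; apply/differentiable_continuous/derivable1_diffP; case: (dg t).
Qed.

Let c11 : continuous (fun t => (g1 t).1). Proof. exact: derive_continuous d11. Qed.
Let c12 : continuous (fun t => (g1 t).2). Proof. exact: derive_continuous d12. Qed.

Definition sup_norm (z : R * R) : R := Num.max `|z.1| `|z.2|.

Let dot_le z v (C : R) : `|v.1| <= C -> `|v.2| <= C ->
  `|dot z v| <= 2 * C * sup_norm z.
Proof.
move=> v1 v2; apply: le_trans (ler_normD _ _) _; rewrite !normrM.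
have C0 : 0 <= C by apply: le_trans v1.
have z1 : `|z.1| <= sup_norm z by rewrite le_max lexx.
have z2 : `|z.2| <= sup_norm z by rewrite le_max lexx orbT.
have := ler_pM (normr_ge0 z.1) (normr_ge0 v.1) z1 v1.
have := ler_pM (normr_ge0 z.2) (normr_ge0 v.2) z2 v2.
lra.
Qed.

Let bounded_on01 (g : R -> R) : continuous g ->
  exists C, forall t, 0 <= t <= 1 -> `|g t| <= C.
Proof.
move=> cg; have cn : continuous (fun t => `|g t|).
  by move=> t; apply: cvg_norm; exact: cg.
have [c _ hc] := EVT_max ler01 (continuous_subspaceT cn).
by exists `|g c| => t t01; apply: hc; rewrite in_itv.
Qed.

Let uniformly_continuous_on01 (g : R -> R) (e : R) : continuous g -> 0 < e ->
  exists n0 : nat, forall n, (n0 <= n)%N -> forall t, 0 <= t <= 1 ->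
    forall s, `|s - t| <= 2 ^- n -> `|g s - g t| <= e.
Proof.
move=> cg e0.
have /compact_near_coveringP cov := @segment_compact R 0 1.
have := cov nat \oo (fun n t => forall s, `|s - t| <= 2 ^- n -> `|g s - g t| <= e) _.
case.
  move=> x _; have e20 : 0 < e / 2 by rewrite divr_gt0.
  have /cvgrPdist_le /(_ _ e20) := cg x.
  rewrite near_simpl => /nbhs_ballP[r /= r0 hr].
  have r20 : 0 < r / 2 by rewrite divr_gt0.
  have hp : \forall n \near \oo, 2 ^- n < r / 2 :> R.
    have := @cvg_expr _ (2^-1 : R).
    rewrite ger0_norm// invf_lt1// ltr1n => /(_ isT) /cvgrPdist_lt /(_ _ r20).
    by apply: filterS => n; rewrite sub0r normrN exprVn ger0_norm.
  exists (ball x (r / 2), [set n | 2 ^- n < r / 2 :> R]).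
    by split => //=; exact: nbhsx_ballx.
  move=> [y n] /= [xy nr] s sy.
  have xy' : `|x - y| < r / 2 := xy.
  have hy : `|g x - g y| <= e / 2.
    by apply: hr; rewrite /ball /= (lt_trans xy')// ltr_pdivrMr// ltr_pMr// ltr1n.
  have hs : `|g x - g s| <= e / 2.
    apply: hr; rewrite /ball /=; have := ler_distD y x s.
    rewrite (distrC y s); lra.
  have := ler_distD (g x) (g s) (g y); rewrite (distrC (g s) (g x)); lra.
move=> n0 _ hn0; exists n0 => n nn t t01; apply: (hn0 n nn).
by rewrite /= in_itv.
Qed.

(** Cramer's rule: z is recovered from its scalar products with v and w. *)
Let sup_norm_det (z v w : R * R) (C : R) :
  `|v.1| <= C -> `|v.2| <= C -> `|w.1| <= C -> `|w.2| <= C ->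
  sup_norm z * `|det2 v w| <= C * (`|dot z v| + `|dot z w|).
Proof.
move=> v1 v2 w1 w2; have C0 : 0 <= C by apply: le_trans v1.
have ab i j : `|i| <= C -> `|j| <= C ->
    `|dot z v * i - dot z w * j| <= C * (`|dot z v| + `|dot z w|).
  move=> iC jC; apply: le_trans (ler_normB _ _) _; rewrite !normrM mulrDr.
  by apply: lerD; rewrite mulrC ler_wpM2r.
rewrite /sup_norm maxr_pMl ?normr_ge0// ge_max; apply/andP; split.
  rewrite -normrM (_ : z.1 * det2 v w = dot z v * w.2 - dot z w * v.2) ?ab//.
  by rewrite /det2 /dot; ring.
rewrite -normrM (_ : z.2 * det2 v w = - (dot z v * w.1 - dot z w * v.1)).
  by rewrite normrN ab.
by rewrite /det2 /dot; ring.
Qed.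

(* On short arcs, nondegeneracy keeps either the first or the second          *)
(* derivative of the phase away from zero, uniformly in its direction.        *)
Lemma phase_oscillation : exists C : R, exists n0 : nat,
  0 <= C /\ forall n, (n0 <= n)%N -> forall u, size u = n ->
  forall (z : R * R) th, 64 ^+ n <= sup_norm z ->
  `|dyadic_average (fun t => cos (dot z (g0 t) + th)) u| <= C / 2 ^+ n.
Proof.
have [C11 h11] := bounded_on01 c11; have [C12 h12] := bounded_on01 c12.
have [C21 h21] := bounded_on01 c21; have [C22 h22] := bounded_on01 c22.
have [D D1 [hD1 hD2]] : exists2 D, 1 <= D &
    (forall t, 0 <= t <= 1 -> `|(g1 t).1| <= D /\ `|(g1 t).2| <= D) /\
    (forall t, 0 <= t <= 1 -> `|(g2 t).1| <= D /\ `|(g2 t).2| <= D).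
  exists (Num.max 1 (Num.max (Num.max C11 C12) (Num.max C21 C22))).
    by rewrite le_max lexx.
  by split=> t t01; rewrite !le_max ?h11 ?h12 ?h21 ?h22 ?orbT.
have D0 : 0 < D by exact: lt_le_trans D1.
(* By [sup_norm_det], lam del <= D times the sum of the sizes of the two derivatives at the left
   end, so one of them is at least 2 c lam there. Its variation over a short arc costs at most c
   lam, and c lam is left. *)
pose c := del / (4 * D).
have c0 : 0 < c by rewrite divr_gt0// mulr_gt0.
have c20 : 0 < c / 2 by rewrite divr_gt0.
have [n11 u11] := uniformly_continuous_on01 c11 c20.
have [n12 u12] := uniformly_continuous_on01 c12 c20.
have [n21 u21] := uniformly_continuous_on01 c21 c20.
have [n22 u22] := uniformly_continuous_on01 c22 c20.
pose K := 4 + 2 * (2 * D) + 4 / c + 2 / c + (2 * D) / c ^+ 2.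
exists K, (maxn (maxn n11 n12) (maxn n21 n22)); split.
  have ci : 0 < c^-1 by rewrite invr_gt0.
  have c2i : 0 < D * (c ^+ 2)^-1 by rewrite mulr_gt0 ?invr_gt0 ?exprn_gt0.
  by rewrite /K; lra.
move=> n; rewrite !geq_max => /andP[/andP[nn11 nn12] /andP[nn21 nn22]] u su z th zn.
have [a0 a1] := left_endpoint_itv R u.
rewrite /dyadic_average su; rewrite su in a1; set a := left_endpoint u in a0 a1 *.
have p0 : 0 < 2 ^- n :> R by rewrite invr_gt0 exprn_gt0.
set lam := sup_norm z in zn.
have lam0 : 0 <= lam by apply: le_trans zn; rewrite exprn_ge0.
have in01 t : a <= t <= a + 2 ^- n -> 0 <= t <= 1.
  by move=> /andP[h1 h2]; rewrite (le_trans a0)//= (le_trans h2).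
have a01 : 0 <= a <= 1 by rewrite a0 (le_trans _ a1)// lerDl ltW.
have near_a t : a <= t <= a + 2 ^- n -> `|t - a| <= 2 ^- n.
  by move=> /andP[h1 h2]; rewrite ger0_norm ?subr_ge0// lerBlDl.
have dot_near (g : R -> R * R) t : `|(g t).1 - (g a).1| <= c / 2 ->
    `|(g t).2 - (g a).2| <= c / 2 ->
    `|dot z (g a)| - c * lam <= `|dot z (g t)|.
  move=> e1 e2; have := @dot_le z (g t - g a) (c / 2) e1 e2.
  have -> : dot z (g t - g a) = dot z (g t) - dot z (g a).
    by rewrite /dot /=; ring.
  have -> : 2 * (c / 2) = c by field.
  have := ler_normB (dot z (g t)) (dot z (g t) - dot z (g a)); rewrite subKr.
  rewrite -/lam; lra.
have big : 2 * c * lam <= `|dot z (g1 a)| \/ 2 * c * lam <= `|dot z (g2 a)|.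
  have [b11 b12] := hD1 a a01; have [b21 b22] := hD2 a a01.
  have := sup_norm_det z b11 b12 b21 b22; rewrite -/lam.
  have := ler_wpM2l lam0 (hdel a).
  have cE : 4 * D * c = del by rewrite /c; field; rewrite gt_eqF.
  move=> h1 h2; have h3 := le_trans h1 h2; rewrite -cE in h3.
  have [h|h] := leP (2 * c * lam) `|dot z (g1 a)|; first by left.
  right; have : lam * (4 * D * c) = D * (4 * c * lam) by ring.
  move=> E; rewrite E ler_pM2l// in h3; lra.
have vdc : `|\int[mu]_(t in `[a, a + 2 ^- n]) cos (dot z (g0 t) + th)| <= K / 4 ^+ n.
  have dph (t : R) : is_derive t 1 (fun t => dot z (g0 t) + th) (dot z (g1 t)).
    have h := is_deriveD (is_deriveD (is_deriveZ z.1 (d01 t)) (is_deriveZ z.2 (d02 t)))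
      (is_derive_cst th t 1).
    by apply: is_derive_eq h _; rewrite addr0.
  have dph1 (t : R) : is_derive t 1 (fun t => dot z (g1 t)) (dot z (g2 t)).
    exact: is_deriveD (is_deriveZ z.1 (d11 t)) (is_deriveZ z.2 (d12 t)).
  have cph2 : continuous (fun t => dot z (g2 t)).
    by move=> t; apply: cvgD; apply: cvgMr; [exact: c21|exact: c22].
  (* s = 4^n has cube 64^n <= lam; normalizing by the arc length turns 4^-n into 2^-n. *)
  apply: (@van_der_corput _ _ _ _ dph dph1 cph2 a (a + 2 ^- n) (2 * D) c lam (4 ^+ n)) => //.
  - by rewrite lerDl (ltW p0)/= lerD2l invf_le1 ?exprn_gt0// exprn_ege1// ler1n.
  - by rewrite mulr_ge0// ltW.
  - by rewrite exprn_ege1// ler1n.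
  - by rewrite -exprM mulnC exprM; apply: le_trans zn; rewrite -natrX.
  - by move=> t /in01/hD2[]; exact: dot_le.
  - case: big => big; [left|right] => t tI.
      have e1 := u11 n nn11 a a01 t (near_a t tI).
      have e2 := u12 n nn12 a a01 t (near_a t tI).
      have := dot_near g1 t e1 e2; lra.
    have e1 := u21 n nn21 a a01 t (near_a t tI).
    have e2 := u22 n nn22 a a01 t (near_a t tI).
    have := dot_near g2 t e1 e2; lra.
rewrite normrM ger0_norm ?exprn_ge0// -ler_pdivlMl ?exprn_gt0//.
apply: le_trans vdc _; rewrite le_eqVlt; apply/orP; left; apply/eqP.
have -> : 4 = 2 * 2 :> R by rewrite -natrM.
by rewrite exprMn; field; rewrite expf_neq0.
Qed.

End phase.

Section curve.
Context (R : realType) (Gamma : circle R -> R * R).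
Hypothesis Gamma_curve : nondegenerate_C2_Jordan_curve Gamma.

Let derive_fst (g : R -> R * R) t : derivable g t 1 ->
  is_derive t 1 (fun s => (g s).1) ((g^`())%classic t).1.
Proof.
move=> dg; have h : h^-1 *: ((g \o shift t) h%:A - g t) @[h --> 0^'] --> (g^`())%classic t.
  by rewrite derive1E; exact: dg.
have h1 : h^-1 *: (((fun s => (g s).1) \o shift t) h%:A - (g t).1) @[h --> 0^']
    --> ((g^`())%classic t).1.
  exact: (cvg_comp _ _ h cvg_fst).
apply: DeriveDef; first by apply/cvg_ex; eexists; exact: h1.
exact: cvg_lim h1.
Qed.

Let derive_snd (g : R -> R * R) t : derivable g t 1 ->
  is_derive t 1 (fun s => (g s).2) ((g^`())%classic t).2.
Proof.
move=> dg; have h : h^-1 *: ((g \o shift t) h%:A - g t) @[h --> 0^'] --> (g^`())%classic t.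
  by rewrite derive1E; exact: dg.
have h1 : h^-1 *: (((fun s => (g s).2) \o shift t) h%:A - (g t).2) @[h --> 0^']
    --> ((g^`())%classic t).2.
  exact: (cvg_comp _ _ h cvg_snd).
apply: DeriveDef; first by apply/cvg_ex; eexists; exact: h1.
exact: cvg_lim h1.
Qed.

Let c1 (g : R -> R * R) : continuous g -> continuous (fun t => (g t).1).
Proof. by move=> cg t; exact: (cvg_comp _ _ (cg t) cvg_fst). Qed.

Let c2 (g : R -> R * R) : continuous g -> continuous (fun t => (g t).2).
Proof. by move=> cg t; exact: (cvg_comp _ _ (cg t) cvg_snd). Qed.

Let inf_pos_le (h : R -> R) : (forall t, 0 <= h t) -> 0 < inf (range h) ->
  exists2 c, 0 < c & forall t, c <= h t.
Proof.
move=> h0 hinf; exists (inf (range h)) => // t.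
by apply: ge_inf; [exists 0 => _ [s _ <-]|exists t].
Qed.

Lemma continuous_cos_phase (z : R * R) th :
  continuous (fun t => cos (dot z (Defs.lift Gamma t) + th)).
Proof.
case: Gamma_curve => _ [dg _ _] _ _.
have cg : continuous (Defs.lift Gamma).
  by move=> t; apply/differentiable_continuous/derivable1_diffP/dg.
move=> t; apply: (@continuous_comp _ _ _ (fun t => dot z (Defs.lift Gamma t) + th) cos).
  apply: cvgD; last exact: cvg_cst.
  by apply: cvgD; apply: cvgMr; [exact: c1|exact: c2].
exact: continuous_cos.
Qed.

Lemma curve_oscillation : exists C : R, exists n0 : nat,
  0 <= C /\ forall n, (n0 <= n)%N -> forall u, size u = n ->
  forall (z : R * R) th, 64 ^+ n <= sup_norm z ->
  `|dyadic_average (fun t => cos (dot z (Defs.lift Gamma t) + th)) u| <= C / 2 ^+ n.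
Proof.
case: Gamma_curve => _ [dg0 dg1 cg2] _ det_inf.
have [del del0 hdel] := inf_pos_le (fun t => normr_ge0 _) det_inf.
apply: (@phase_oscillation _ (Defs.lift Gamma) ((Defs.lift Gamma)^`())%classic
  ((Defs.lift Gamma)^`(2))%classic del) => //.
- by move=> t; exact: derive_fst (dg0 t).
- by move=> t; exact: derive_snd (dg0 t).
- by move=> t; exact: derive_fst (dg1 t).
- by move=> t; exact: derive_snd (dg1 t).
- exact: c1.
- exact: c2.
Qed.

End curve.

(** * Integrals against set functions and restricted measures *)

Section set_function_integral.
Import HBNNSimple.
Context d (T : measurableType d) (R : realType).

(** [cascade_approx] is an unbundled set function. Its integral consults it only on the level sets
    of simple functions, which are measurable, so it may be replaced by a genuine measure. *)
Lemma eq_set_function_integral (m1 : set T -> \bar R)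
    (m2 : {measure set T -> \bar R}) (f : T -> \bar R) :
  (forall A, measurable A -> m1 A = m2 A) ->
  (\int[m1]_x f x = \int[m2]_x f x)%E.
Proof.
move=> m12; rewrite /integral.
have m12h (h : {nnsfun T >-> R}) : sintegral m1 h = sintegral m2 h.
  rewrite !sintegralET; apply: eq_fsbigr => r _; congr (_ * _)%E; apply: m12.
  exact: measurable_sfunP.
by congr (ereal_sup _ - ereal_sup _)%E; apply: eq_imagel => h _; exact: m12h.
Qed.

Lemma ge0_integral_mrestr (m : {measure set T -> \bar R}) (D E : set T)
    (mD : measurable D) (f : T -> \bar R) :
  measurable E -> measurable_fun setT f -> (forall x, (0 <= f x)%E) ->
  (\int[mrestr m mD]_(x in E) f x = \int[m]_(x in E `&` D) f x)%E.
Proof.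
move=> mE mf f0.
rewrite (@ge0_negligible_integral _ _ _ (mrestr m mD) E (~` D))//.
- rewrite setDE setCK; apply: eq_measure_integral => A mA AED.
  by rewrite /= /mrestr (_ : A `&` D = A)//; apply/setIidl => x /AED[].
- exact: measurableC.
- exact: measurable_funTS.
- by rewrite /= /mrestr setICl measure0.
Qed.

End set_function_integral.

(** * Cascade measures on the circle *)

Section circle_integral.
Context (R : realType).
Implicit Types (u : seq bool).

(** In the quotient topology this is openness of the preimage, which is the union of the integer
    translates of A. *)
Lemma open_circle_image (A : set R) : open A -> open (@circle_pi R @` A).
Proof.
move=> oA.
suff : open (@circle_pi R @^-1` (@circle_pi R @` A)) by [].
rewrite (_ : _ @^-1` _ = \bigcup_(z : int) ((fun t => t + z%:~R) @^-1` A)).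
  apply: bigcup_open => z _; apply: open_comp => // t _.
  by apply: (@cvgD _ _ _ _ _ id); [exact: cvg_id|exact: cvg_cst].
apply/seteqP; split=> [t [s As /circle_piP/intrP[z e]]|t [z _ /= Atz]].
  by exists z => //=; rewrite -e addrC subrK.
by exists (t + z%:~R) => //; apply/circle_piP; rewrite addrAC subrr add0r intr_int.
Qed.

Lemma int_lt1_eq0 (x : R) : x \is a Num.int -> `|x| < 1 -> x = 0.
Proof.
move=> /intrP[z ->]; rewrite -intr_norm ltrz1 => z1.
by rewrite (_ : z = 0)//; lia.
Qed.

(** A half-open arc is its left end plus an open arc, and the complement of that point is the image
    of the open interval ]a, a + 1[. *)
Lemma measurable_circle_itvco (a b : R) :
  measurable (@circle_pi R @` `[a, b[%classic).
Proof.
have mo (A : set R) : open A -> measurable (@circle_pi R @` A).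
  by move=> oA; apply: sub_sigma_algebra; exact: open_circle_image.
have [ab|ba] := ltP a b; last first.
  by rewrite set_itv_ge ?bnd_simp -?leNgt// image_set0.
rewrite -(@setU1itv _ _ _ a false) ?bnd_simp// image_setU image_set1.
apply: measurableU; last by apply: mo; exact: itv_open.
rewrite -[X in measurable X]setCK; apply: measurableC.
rewrite (_ : ~` _ = @circle_pi R @` `]a, a + 1[%classic); first by apply: mo; exact: itv_open.
apply/seteqP; split=> [x /= xa|_ [t /= tI <-] /circle_piP/int_lt1_eq0].
  pose t := repr x; pose z := Num.floor (t - a).
  have xE y : y - t \is a Num.int -> circle_pi y = x.
    by move=> /circle_piP ->; rewrite /circle_pi /t reprK.
  have /andP[z1 z2] := real_floor_itv (num_real (t - a)).
  exists (t - z%:~R); last by apply: xE; rewrite addrAC subrr add0r rpredN intr_int.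
  rewrite /= in_itv/=; apply/andP; split; last first.
    by move: z2; rewrite -/z intrD; lra.
  rewrite lt_neqAle; apply/andP; split; last by move: z1; rewrite -/z; lra.
  apply/eqP => e; apply: xa; rewrite [in RHS]e; apply/esym; apply: xE.
  by rewrite addrAC subrr add0r rpredN intr_int.
move: tI; rewrite in_itv/= => /andP[h1 h2].
rewrite ger0_norm ?subr_ge0 ?ltW// ltrBlDl h2 => /(_ isT) h; lra.
Qed.

Lemma measurable_dyadic_arc u : measurable (@dyadic_arc R u).
Proof. exact: measurable_circle_itvco. Qed.

Lemma circle_pi_dyadic_arc u (t : R) : 0 <= t < 1 ->
  dyadic_arc u (circle_pi t) <->
  left_endpoint u <= t < left_endpoint u + 2 ^- size u.
Proof.
move=> /andP[t0 t1]; have [l0 l1] := left_endpoint_itv R u.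
split=> [[s /=]|tI]; last by exists t => //; rewrite /= in_itv.
rewrite in_itv/= => /andP[s0 s1] /circle_piP/int_lt1_eq0 st.
suff -> : t = s by rewrite s0.
apply/esym/eqP; rewrite -subr_eq0; apply/eqP/st.
by rewrite ltr_norml; apply/andP; split; lra.
Qed.

Lemma continuous_circle_measurable (f : circle R -> R) :
  continuous f -> measurable_fun setT f.
Proof.
move=> cf; apply: (measurability _ (RGenOpens.measurableE R)).
move=> _ [_ [a [b ->]] <-]; rewrite setTI; apply: sub_sigma_algebra.
by move/continuousP: cf; apply; exact: itv_open.
Qed.

Lemma integral_dyadic_arc u (f : circle R -> R) :
  continuous f -> (forall x, 0 <= f x) ->
  (\int[haar R]_(x in dyadic_arc u) (f x)%:E =
   (2 ^- size u * dyadic_average (f \o circle_pi) u)%:E)%E.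
Proof.
move=> cf f0.
have cfp : continuous (f \o @circle_pi R).
  by move=> t; apply: (@continuous_comp _ _ _ (@circle_pi R) f);
    [exact: continuous_circle_pi|exact: cf].
have mf := continuous_circle_measurable cf.
have mpi := @measurable_circle_pi R.
rewrite /haar ge0_integral_pushforward//; last 3 first.
- exact: measurable_dyadic_arc.
- by apply/measurable_EFinP; exact: measurable_funTS.
- by move=> x _; rewrite lee_fin.
have mA : measurable (@circle_pi R @^-1` dyadic_arc u).
  by rewrite -[X in measurable X]setTI; apply: mpi => //; exact: measurable_dyadic_arc.
rewrite ge0_integral_mrestr//; last 2 first.
- by apply/measurable_EFinP; exact: continuous_measurable_fun.
- by move=> x; rewrite lee_fin.
have [l0 l1] := left_endpoint_itv R u.
rewrite (_ : _ `&` _ = `[left_endpoint u, left_endpoint u + 2 ^- size u[%classic); last first.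
  apply/seteqP; split=> [t [/= tA]|t /=]; rewrite !in_itv/=.
    by move=> t01; apply/circle_pi_dyadic_arc.
  move=> /[dup] tI /andP[h1 h2].
  have t01 : 0 <= t < 1 by rewrite (le_trans l0)//= (lt_le_trans h2).
  by split => //; apply/circle_pi_dyadic_arc.
rewrite integral_itv_bndo_bndc; last first.
  by apply: measurable_funTS; apply/measurable_EFinP; exact: continuous_measurable_fun.
rewrite /dyadic_average mulrA mulVf ?mul1r ?expf_neq0//.
rewrite /Rintegral fineK//.
exact: (integrable_fin_num _ (continuous_itv_integrable _ _ cfp)).
Qed.

End circle_integral.

Section cascade_integral.
Context (R : realType) d (Omega : measurableType d) (P : probability Omega R)
  (X : seq bool -> {RV P >-> R}).

Lemma big_words_tuple (V : nmodType) n (F : seq bool -> V) :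
  \sum_(u : n.-tuple bool) F u = \sum_(u <- words n) F u.
Proof.
rewrite -(big_map (fun u : n.-tuple bool => val u) xpredT F) /=.
apply: perm_big; apply: uniq_perm.
- by rewrite map_inj_uniq; [exact: index_enum_uniq|exact: val_inj].
- exact: uniq_words.
- move=> u; apply/mapP/idP => [[v _ ->]|/size_words su].
    by apply: mem_words; rewrite size_tuple.
  by exists (tcast su (in_tuple u)); rewrite ?mem_index_enum// val_tcast.
Qed.

Variable w : Omega.
Hypothesis X_ge0 : forall u, nonempty_words u -> 0 <= X u w.

Lemma amplitude_amp u : amplitude X u w = amp (X ^~ w) u.
Proof.
elim/last_ind: u => [|u i ih].
  by rewrite /amplitude /= big_geq// expr0 invr1 mulr1.
rewrite amp_rcons -ih /amplitude size_rcons big_nat_recr//= -(size_rcons u i) take_size.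
rewrite /pos_part (max_l (X_ge0 _)); last by rewrite /nonempty_words /=; case: (u).
rewrite size_rcons exprS invfM.
have -> : \prod_(1 <= k < (size u).+1) X (take k (rcons u i)) w =
          \prod_(1 <= k < (size u).+1) X (take k u) w.
  apply: eq_big_nat => k /andP[_ ku]; rewrite -cats1 takel_cat//.
by ring.
Qed.

Lemma integral_cascade_approx n (f : circle R -> R) :
  continuous f -> (forall x, 0 <= f x) ->
  (\int[cascade_approx X n w]_x (f x)%:E =
   (cascade_sum X (dyadic_average (f \o circle_pi)) n w)%:E)%E.
Proof.
move=> cf f0.
(* The measure replacing [cascade_approx] is a finite sum of Haar measures restricted to arcs and
   scaled; the scaling factors need to be nonnegative outright, hence [amp] instead of
   [amplitude]. *)
pose c (u : seq bool) : {nonneg R} :=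
  NngNum (mulr_ge0 (exprn_ge0 n (ler0n R 2)) (amp_ge0 (X ^~ w) u)).
pose nu (i : nat) : {measure set (circle R) -> \bar R} :=
  mscale (c (nth [::] (words n) i))
    (mrestr (haar R) (measurable_dyadic_arc (nth [::] (words n) i))).
have mf := continuous_circle_measurable cf.
rewrite (@eq_set_function_integral _ _ _ _ (msum nu (size (words n)))); last first.
  move=> A mA; rewrite /cascade_approx /msum.
  rewrite (eq_integral (fun x => \sum_(u <- words n)
      ((2 ^+ n * amplitude X u w)%:E * (\1_(dyadic_arc u) x)%:E))%E); last first.
    move=> x _; rewrite /cascade_density -sumEFin.
    exact: (big_words_tuple n (fun u =>
      ((2 ^+ n * amplitude X u w)%:E * (\1_(dyadic_arc u) x)%:E)%E)).
  rewrite ge0_integral_sum//; last 2 first.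
  - by move=> u; apply/measurable_EFinP/measurable_funTS;
      apply: measurable_funM => //; apply: measurable_indic; exact: measurable_dyadic_arc.
  - by move=> u x _; rewrite -EFinM lee_fin amplitude_amp !mulr_ge0 ?amp_ge0.
  rewrite (big_nth [::]) big_mkord; apply: eq_bigr => i _.
  set u := nth _ _ _.
  rewrite ge0_integralZl//; last 2 first.
  - by apply/measurable_EFinP/measurable_funTS/measurable_indic; exact: measurable_dyadic_arc.
  - by rewrite lee_fin amplitude_amp mulr_ge0 ?amp_ge0.
  rewrite integral_indic ?amplitude_amp//; last exact: measurable_dyadic_arc.
  by rewrite /nu /= /mscale /mrestr /c /= setIC.
have mEf : measurable_fun setT (EFin \o f) by exact/measurable_EFinP.
rewrite ge0_integral_measure_sum//; last by move=> x _; rewrite lee_fin.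
rewrite /cascade_sum (big_nth [::]) big_mkord -sumEFin.
apply: eq_bigr => i _; rewrite /nu.
rewrite ge0_integral_mscale//; last by move=> x _; rewrite lee_fin.
rewrite ge0_integral_mrestr// setTI integral_dyadic_arc//.
have -> : size (nth [::] (words n) i) = n by apply/size_words/mem_nth.
by rewrite -EFinM /c /= mulrACA mulfV ?expf_neq0// mul1r.
Qed.

End cascade_integral.

Section cascade_limit.
Context (R : realType) d (Omega : measurableType d) (P : probability Omega R)
  (X : seq bool -> {RV P >-> R}) (w : Omega)
  (mu : {finite_measure set (circle R) -> \bar R}).
Hypothesis X_ge0 : forall u, nonempty_words u -> 0 <= X u w.
Hypothesis X_cvg : weak_cvg (fun n => cascade_approx X n w) mu.

Lemma bounded_circle_integrable (f : circle R -> R) (C : R) :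
  continuous f -> (forall x, `|f x| <= C) -> mu.-integrable setT (EFin \o f).
Proof.
move=> cf fC; apply: (integrable_dominated (g := cst C)).
- exact: continuous_circle_measurable.
- by move=> x; exact: fC.
- exact: finite_measure_integrable_cst.
Qed.

Lemma cascade_sum_cvg_ge0 (f : circle R -> R) (C : R) :
  continuous f -> (forall x, 0 <= f x <= C) ->
  cascade_sum X (dyadic_average (f \o circle_pi)) n w @[n --> \oo] -->
  \int[mu]_x f x.
Proof.
move=> cf fC; have f0 x : 0 <= f x by have /andP[] := fC x.
have fi : mu.-integrable setT (EFin \o f).
  by apply: (bounded_circle_integrable (C := C)) => // x; rewrite ger0_norm//; have /andP[] := fC x.
have := X_cvg cf.
under eq_fun do rewrite (integral_cascade_approx X_ge0)//.
rewrite (_ : (\int[mu]_x (f x)%:E)%E = (\int[mu]_x f x)%:E); last first.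
  by rewrite /Rintegral fineK//; exact: integrable_fin_num fi.
by move/fine_cvg.
Qed.

Lemma dyadic_average_cst (C : R) u : dyadic_average (cst C) u = C.
Proof.
rewrite /dyadic_average Rintegral_cst//= lebesgue_measure_itv/= lte_fin ltrDl invr_gt0 exprn_gt0//=.
rewrite addrAC subrr add0r mulrCA mulfV ?mulr1//.
Qed.

Lemma dyadic_averageD (f g : R -> R) u : continuous f -> continuous g ->
  dyadic_average (fun t => f t + g t) u = dyadic_average f u + dyadic_average g u.
Proof.
move=> cf cg; rewrite /dyadic_average RintegralD ?mulrDr//;
  exact: continuous_itv_integrable.
Qed.

(** Reduction to nonnegative functions by adding the constant C, since only those were integrated
    against [cascade_approx]. *)
Lemma cascade_sum_cvg (f : circle R -> R) (C : R) :
  continuous f -> (forall x, `|f x| <= C) ->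
  cascade_sum X (dyadic_average (f \o circle_pi)) n w @[n --> \oo] -->
  \int[mu]_x f x.
Proof.
move=> cf fC; have C0 : 0 <= C by exact: le_trans (fC (circle_pi 0)).
have fi := bounded_circle_integrable cf fC.
have cC : continuous (cst C : circle R -> R) by exact: cst_continuous.
have cfC : continuous (fun x : circle R => f x + C).
  move=> x; apply: (@continuousD _ _ _ f (cst C)); [exact: cf|exact: cst_continuous].
have h1 : cascade_sum X (dyadic_average (cst C \o circle_pi)) n w @[n --> \oo] --> \int[mu]_x C.
  by apply: (cascade_sum_cvg_ge0 (C := C)) => // x; rewrite C0 lexx.
have h2 : cascade_sum X (dyadic_average ((fun x => f x + C) \o circle_pi)) n w @[n --> \oo]
    --> \int[mu]_x (f x + C).
  apply: (cascade_sum_cvg_ge0 (C := C + C)) => // x.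
  by have := fC x; rewrite ler_norml => /andP[h3 h4]; apply/andP; split; lra.
rewrite (_ : \int[mu]_x f x = \int[mu]_x (f x + C) - \int[mu]_x C); last first.
  by rewrite RintegralD// ?addrK//; exact: finite_measure_integrable_cst.
rewrite (_ : (fun n => _) = (fun n =>
  cascade_sum X (dyadic_average ((fun x => f x + C) \o circle_pi)) n w -
  cascade_sum X (dyadic_average (cst C \o circle_pi)) n w)); first exact: cvgB.
apply/funext => n; rewrite /cascade_sum -sumrB; apply: eq_bigr => u _.
rewrite -mulrBr; congr (_ * _).
have cfp : continuous (f \o @circle_pi R).
  by move=> t; apply: (@continuous_comp _ _ _ (@circle_pi R) f);
    [exact: continuous_circle_pi|exact: cf].
have := @dyadic_averageD (f \o circle_pi) (cst C) u cfp (fun t => cvg_cst C).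
by rewrite /comp/= => ->; rewrite addrK.
Qed.

Lemma cascade_sum1_bounded : exists2 K, 0 <= K & forall k, cascade_sum X (fun=> 1) k w <= K.
Proof.
have h : cascade_sum X (dyadic_average (cst 1 \o circle_pi)) n w @[n --> \oo] -->
    \int[mu]_x (1 : R).
  apply: (cascade_sum_cvg (f := cst 1) (C := 1)) => [|x]; first exact: cst_continuous.
  by rewrite normr1.
have /cvg_seq_bounded [K [_ /(_ (`|K| + 1))]] :
    cvgn (fun n => cascade_sum X (dyadic_average (cst 1 \o circle_pi)) n w).
  by apply/cvg_ex; exists (\int[mu]_x (1 : R)).
have h1 : K < `|K| + 1 by rewrite (le_lt_trans (ler_norm K))// ltrDl.
move=> /(_ h1) hK; exists (`|K| + 1); first by rewrite addr_ge0.
move=> k; apply: le_trans (hK k I); apply: le_trans (ler_norm _).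
rewrite le_eqVlt; apply/orP; left; apply/eqP; apply: eq_bigr => u _.
by congr (_ * _); apply/esym; exact: dyadic_average_cst.
Qed.

End cascade_limit.

(** * Fourier decay *)

Section grid.
Context (R : realType) (b : nat).
Hypothesis b_ge2 : (2 <= b)%N.

(** The multiples of 2^-k of absolute value at most b^(k+1) / 2^k. For b >= 2 these grids increase
    with k, so a point chosen at level n is still available at all later levels, as
    [cascade_limit_bound] demands. *)
Definition grid k : seq R :=
  [seq (a%:R - (b ^ k.+1)%:R) / 2 ^+ k | a <- iota 0 (2 * b ^ k.+1).+1].

Lemma size_grid k : size (grid k) = (2 * b ^ k.+1).+1.
Proof. by rewrite size_map size_iota. Qed.

Lemma grid_approx k (x m : R) : `|x| <= m -> 2 ^+ k * (m + 1) <= b%:R ^+ k.+1 ->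
  exists2 y, (forall j, (k <= j)%N -> y \in grid j) & `|x - y| <= 2 ^- k.
Proof.
move=> xm mb; have p0 : 0 < 2 ^+ k :> R by rewrite exprn_gt0.
have p1 : 1 <= 2 ^+ k :> R by rewrite exprn_ege1// ler1n.
pose p := Num.floor (2 ^+ k * x).
have /andP[z1 z2] := real_floor_itv (num_real (2 ^+ k * x)).
have {}z1 : p%:~R <= 2 ^+ k * x by [].
have {}z2 : 2 ^+ k * x < p%:~R + 1 by move: z2; rewrite intrD.
exists (p%:~R / 2 ^+ k); last first.
  rewrite (_ : x - _ = (2 ^+ k * x - p%:~R) / 2 ^+ k); last by field; rewrite expf_neq0.
  rewrite normrM (gtr0_norm (x := _^-1)) ?invr_gt0// ger0_norm ?subr_ge0//.
  by rewrite ler_piMl ?invr_ge0 ?ltW//; lra.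
have {z1 z2 mb xm} pb : `|p| <= (b ^ k.+1)%:Z.
  rewrite -(ler_int R) intr_norm [X in _ <= X](_ : _ = b%:R ^+ k.+1); last by rewrite -natrX.
  apply: le_trans mb; rewrite ler_norml.
  move: xm; rewrite ler_norml => /andP[x1 x2].
  have := ler_wpM2l (ltW p0) x1; have := ler_wpM2l (ltW p0) x2.
  rewrite mulrN mulrDr mulr1 => h1 h2.
  by apply/andP; split; lra.
(* The numerator of the same point over 2^j; its growth by 2^(j-k) is absorbed by b^(j-k). *)
move=> j kj; pose s := p * (2 ^ (j - k))%:Z.
have sb : `|s| <= (b ^ j.+1)%:Z.
  rewrite normrM [`|_%:Z|]ger0_norm// (_ : j.+1 = k.+1 + (j - k))%N; last by lia.
  rewrite expnD PoszM; apply: ler_pM => //.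
  by rewrite lez_nat; case: (j - k)%N => // i; rewrite leq_exp2r.
apply/mapP; exists (absz (s + (b ^ j.+1)%:Z)).
  by rewrite mem_iota /=; lia.
have -> : (absz (s + (b ^ j.+1)%:Z))%:R = s%:~R + (b ^ j.+1)%:R :> R.
  by rewrite pmulrn gez0_abs ?intrD//; lia.
rewrite addrK /s intrM -pmulrn natrX.
have -> : 2 ^+ j = 2 ^+ (j - k) * 2 ^+ k :> R by rewrite -exprD subnK.
by field; rewrite !expf_neq0.
Qed.

End grid.

Section plane_estimates.
Context (R : realType).
Implicit Types z y : R * R.

Lemma cos_lipschitz (a b : R) : `|cos a - cos b| <= `|a - b|.
Proof.
wlog ab : a b / a <= b.
  by move=> h; case: (leP a b) => [|/ltW] /h//; rewrite distrC [X in _ <= X]distrC.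
have cc : {within `[a, b], continuous (@cos R)}.
  by apply: continuous_subspaceT => x; exact: continuous_cos.
have [c _] := @MVT_segment R cos (fun x => - sin x) a b ab (fun x _ => is_derive_cos x) cc.
rewrite distrC [X in _ <= X]distrC => ->.
rewrite normrM normrN ler_piMl//; rewrite ler_norml sin_geN1 sin_le1//.
Qed.

Lemma sup_norm_le z C : `|z.1| <= C -> `|z.2| <= C -> sup_norm z <= C.
Proof. by rewrite /sup_norm ge_max => -> ->. Qed.

Lemma euclidean_norm_le z : euclidean_norm z <= 2 * sup_norm z.
Proof.
have s0 : 0 <= sup_norm z by rewrite /sup_norm le_max normr_ge0.
rewrite -[X in _ <= X](ger0_norm (mulr_ge0 (ler0n R 2) s0)) -sqrtr_sqr /euclidean_norm.
apply: ler_wsqrtr; rewrite /dot.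
have h1 : `|z.1| <= sup_norm z by rewrite /sup_norm le_max lexx.
have h2 : `|z.2| <= sup_norm z by rewrite /sup_norm le_max lexx orbT.
have e1 : z.1 * z.1 = `|z.1| ^+ 2 by rewrite real_normK ?num_real.
have e2 : z.2 * z.2 = `|z.2| ^+ 2 by rewrite real_normK ?num_real.
have := normr_ge0 z.1; have := normr_ge0 z.2.
rewrite e1 e2; nra.
Qed.

Lemma normc_le (a b : R) : Normc.normc (Complex a b) <= `|a| + `|b|.
Proof.
rewrite /Normc.normc -[X in _ <= X](ger0_norm (addr_ge0 (normr_ge0 a) (normr_ge0 b))).
rewrite -sqrtr_sqr; apply: ler_wsqrtr.
rewrite sqrrD !real_normK ?num_real// lerD2r lerDl mulrn_wge0// mulr_ge0//.
Qed.

Lemma exists_expr_lt (q x : R) : 1 < q -> 1 <= x ->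
  exists n, q ^+ n <= x < q ^+ n.+1.
Proof.
move=> q1 x1; have [N xN] := exists_expr_ge (x + 1) q1.
have ex : exists n, x < q ^+ n by exists N; apply: lt_le_trans xN; rewrite ltrDl.
case: (ex_minnP ex) => -[|n] xn nmin; first by move: xn; rewrite expr0 ltNge x1.
exists n; rewrite xn andbT leNgt; apply/negP => /nmin.
by rewrite ltnn.
Qed.

Lemma cvg_norm_le_frequently (s : nat -> R) l B : s n @[n --> \oo] --> l ->
  (forall m, exists2 k, (m <= k)%N & `|s k| <= B) -> `|l| <= B.
Proof.
move=> sl sB; apply/ler_addgt0Pr => e e0.
have /cvgrPdist_le /(_ e e0) [m _ hm] := sl.
have [k mk sk] := sB m.
have := hm k mk => /= h.
rewrite -(subrK (s k) l) (le_trans (ler_normD _ _))// addrC lerD//.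
Qed.

End plane_estimates.

Section curve_phase.
Context (R : realType) (Gamma : circle R -> R * R).
Hypothesis Gamma_curve : nondegenerate_C2_Jordan_curve Gamma.

Let cGamma : continuous Gamma.
Proof. by case: Gamma_curve => -[]. Qed.

Let cG1 : continuous (fun x => (Gamma x).1).
Proof. by move=> x; exact: (cvg_comp _ _ (@cGamma x) cvg_fst). Qed.

Let cG2 : continuous (fun x => (Gamma x).2).
Proof. by move=> x; exact: (cvg_comp _ _ (@cGamma x) cvg_snd). Qed.

(** The shift lets one family carry both parts of the transform: [th] = 0 gives the cosine and - pi
    / 2 the sine. *)
Definition phase (z : R * R) (th : R) (x : circle R) : R := cos (dot z (Gamma x) + th).

Lemma phase_le1 z th x : `|phase z th x| <= 1.
Proof. by rewrite ler_norml cos_geN1 cos_le1. Qed.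

Lemma continuous_phase z th : continuous (phase z th).
Proof.
move=> x; apply: (@continuous_comp _ _ _ (fun x => dot z (Gamma x) + th) cos).
  apply: (@continuousD _ _ _ (fun x => dot z (Gamma x)) (cst th)); last exact: cst_continuous.
  apply: (@continuousD _ _ _ (fun x => z.1 * (Gamma x).1) (fun x => z.2 * (Gamma x).2)).
    by apply: (@continuousM _ _ (cst z.1) (fun x => (Gamma x).1));
      [exact: cst_continuous|exact: cG1].
  by apply: (@continuousM _ _ (cst z.2) (fun x => (Gamma x).2));
    [exact: cst_continuous|exact: cG2].
exact: continuous_cos.
Qed.

Lemma curve_bounded : exists2 G : R, 0 <= G & forall x, sup_norm (Gamma x) <= G.
Proof.
pose h (t : R) := `|(Gamma (circle_pi t)).1| + `|(Gamma (circle_pi t)).2|.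
have ch : continuous h.
  move=> t; apply: cvgD; apply: cvg_norm.
    by apply: (@continuous_comp _ _ _ (@circle_pi R) (fun x => (Gamma x).1));
      [exact: continuous_circle_pi|exact: cG1].
  by apply: (@continuous_comp _ _ _ (@circle_pi R) (fun x => (Gamma x).2));
    [exact: continuous_circle_pi|exact: cG2].
have [c _ hc] := EVT_max (@ler01 R) (continuous_subspaceT ch).
exists (h c) => [|x]; first by rewrite addr_ge0.
have <- : circle_pi (repr x - (Num.floor (repr x))%:~R) = x.
  rewrite -[RHS]reprK; apply/circle_piP.
  by rewrite addrAC subrr add0r rpredN intr_int.
set t := _ - _; have tI : t \in `[0, 1].
  have /andP[z1 z2] := real_floor_itv (num_real (repr x : R)).
  by rewrite in_itv/= /t; move: z2; rewrite intrD => z2; apply/andP; split; lra.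
apply: le_trans (hc t tI).
by apply: sup_norm_le; [rewrite lerDl|rewrite lerDr].
Qed.

Variable mu : {finite_measure set (circle R) -> \bar R}.

Lemma phase_integrable z th : mu.-integrable setT (EFin \o phase z th).
Proof.
exact: bounded_circle_integrable (@continuous_phase z th) (phase_le1 z th).
Qed.

Lemma phase_integral_dist z y th del G : `|z.1 - y.1| <= del -> `|z.2 - y.2| <= del ->
  (forall x, sup_norm (Gamma x) <= G) ->
  `|\int[mu]_x phase z th x| <=
  `|\int[mu]_x phase y th x| + 2 * del * G * fine (mu setT).
Proof.
move=> zy1 zy2 hG.
have hz := phase_integrable z th; have hy := phase_integrable y th.
rewrite addrC -lerBlDr; apply: le_trans (lerB_dist _ _) _.
rewrite -RintegralB//; apply: le_trans (le_normr_Rintegral _ _) _ => //.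
  by have := integrableB measurableT hz hy.
rewrite -Rintegral_cst//; apply: le_Rintegral => //.
- by have := integrableB measurableT hz hy => /integrable_norm.
- exact: finite_measure_integrable_cst.
move=> x _; apply: le_trans (cos_lipschitz _ _) _.
have -> : dot z (Gamma x) + th - (dot y (Gamma x) + th) =
   (z.1 - y.1) * (Gamma x).1 + (z.2 - y.2) * (Gamma x).2 by rewrite /dot; ring.
have := hG x; rewrite /sup_norm ge_max => /andP[g1 g2].
apply: le_trans (ler_normD _ _) _; rewrite !normrM.
rewrite (_ : 2 * del * G = del * G + del * G); last by ring.
by apply: lerD; apply: ler_pM.
Qed.

Lemma fourier_pushforward xi : fourier (pushforward mu Gamma) xi =
  Complex (\int[mu]_x phase (2 * pi * xi.1, 2 * pi * xi.2) 0 x)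
    (- \int[mu]_x phase (2 * pi * xi.1, 2 * pi * xi.2) (- (pi / 2)) x).
Proof.
have mG : measurable_fun setT Gamma.
  rewrite (_ : Gamma = fun x => ((Gamma x).1, (Gamma x).2)); last first.
    by apply/funext => x; case: (Gamma x).
  by apply: measurable_fun_pair; exact: continuous_circle_measurable.
have mdot : measurable_fun setT (fun x : R * R => 2 * pi * dot xi x).
  apply: measurable_funM => //; apply: measurable_funD; apply: measurable_funM => //.
have dotE x : dot (2 * pi * xi.1, 2 * pi * xi.2) x = 2 * pi * dot xi x.
  by rewrite /dot /=; ring.
have push (f : R -> R) th : measurable_fun setT f ->
    (forall t, f t = cos (t + th)) ->
    fine (\int[pushforward mu Gamma]_x (f (2 * pi * dot xi x))%:E)%E =
    \int[mu]_x phase (2 * pi * xi.1, 2 * pi * xi.2) th x.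
  move=> mf fE; rewrite integral_pushforward//.
  - congr fine; apply: eq_integral => x _.
    by rewrite /= fE /phase dotE.
  - by apply/measurable_EFinP; exact: (measurableT_comp mf mdot).
  - apply: eq_integrable (phase_integrable (2 * pi * xi.1, 2 * pi * xi.2) th) => // x _.
    by rewrite /= fE /phase dotE.
rewrite /fourier (push cos 0) ?(push sin (- (pi / 2)))//.
- exact: continuous_measurable_fun (@continuous_sin R).
- by move=> t; rewrite cosBpihalf.
- exact: continuous_measurable_fun (@continuous_cos R).
- by move=> t; rewrite addr0.
Qed.

End curve_phase.

Section phase_family.
Context (R : realType) (Gamma : circle R -> R * R).
Hypothesis Gamma_curve : nondegenerate_C2_Jordan_curve Gamma.

Definition phase_average (i : (R * R) * R) (u : seq bool) : R :=
  dyadic_average (fun t => cos (dot i.1 (Defs.lift Gamma t) + i.2)) u.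

Lemma phase_average_harmonic i : harmonic (phase_average i).
Proof. by move=> u; apply: dyadic_average_split; exact: continuous_cos_phase. Qed.

Lemma phase_average_le1 i u : `|phase_average i u| <= 1.
Proof.
apply: dyadic_average_le; first exact: continuous_cos_phase.
by move=> t; rewrite ler_norml cos_geN1 cos_le1.
Qed.

Definition frequencies b (k : nat) : seq ((R * R) * R) :=
  [seq (z, th) | z <- [seq (x, y) | x <- grid R b k, y <- grid R b k],
                 th <- [:: 0; - (pi / 2)]].

Lemma size_frequencies b k : (0 < b)%N ->
  (size (frequencies b k) <= 18 * (b * b) * (b * b) ^ k)%N.
Proof.
move=> b0; rewrite !size_allpairs size_grid /= expnMn expnS.
have : (0 < b ^ k)%N by rewrite expn_gt0 b0.
move: (b ^ k)%N => v v0.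
have -> : (18 * (b * b) * (v * v) = 18 * ((b * v) * (b * v)))%N by lia.
have : (0 < b * v)%N by rewrite muln_gt0 b0.
by move: (b * v)%N => t t0; nia.
Qed.

Context d (Omega : measurableType d) (P : probability Omega R)
  (X : seq bool -> {RV P >-> R}) (w : Omega)
  (mu : {finite_measure set (circle R) -> \bar R}).
Hypothesis X_ge0 : forall u, nonempty_words u -> 0 <= X u w.
Hypothesis X_cvg : weak_cvg (fun n => cascade_approx X n w) mu.
Variable b : nat.
Hypotheses (b_ge2 : (2 <= b)%N) (b_ge : 8 * 64 <= b%:R :> R).
Hypothesis X_bound : forall K : R, (forall k, cascade_sum X (fun=> 1) k w <= K) ->
  forall e : R, 0 < e -> exists n1 : nat, forall n, (n1 <= n)%N ->
  forall i (eta : R), (forall k, (n <= k)%N -> i \in frequencies b k) ->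
  (forall u, size u = n -> `|phase_average i u| <= eta) ->
  forall m, exists2 k, (m <= k)%N & `|cascade_sum X (phase_average i) k w| <= eta * K + e.

Lemma frequency_approx n (z : R * R) : sup_norm z <= 2 * 64 ^+ n.+1 ->
  exists y, [/\ `|z.1 - y.1| <= 2 ^- n, `|z.2 - y.2| <= 2 ^- n &
    forall k, (n <= k)%N -> (y, 0) \in frequencies b k /\ (y, - (pi / 2)) \in frequencies b k].
Proof.
rewrite /sup_norm ge_max => /andP[z1 z2].
(* This fixes the size of b: a factor 64 per level covers the range of frequencies, and a factor 8
   covers the denominators 2^n and the constants. *)
have hb : 2 ^+ n * (2 * 64 ^+ n.+1 + 1) <= (b%:R : R) ^+ n.+1.
  apply: (@le_trans _ _ ((8 * 64) ^+ n.+1)); last by rewrite lerXn2r ?nnegrE.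
  rewrite exprMn [8 ^+ _]exprS.
  have h1 : 1 <= 64 ^+ n.+1 :> R by rewrite exprn_ege1// ler1n.
  have h2 : 2 ^+ n <= 8 ^+ n :> R by rewrite lerXn2r ?nnegrE// ler_nat.
  have h3 : 0 <= 2 ^+ n :> R by rewrite exprn_ge0.
  move: h1 h2 h3; move: (64 ^+ n.+1) (2 ^+ n) (8 ^+ n) => x y v x1 yv y0.
  by nra.
have [y1 y1g zy1] := grid_approx b_ge2 z1 hb.
have [y2 y2g zy2] := grid_approx b_ge2 z2 hb.
exists (y1, y2); split=> // k nk.
have yk : (y1, y2) \in [seq (x, y) | x <- grid R b k, y <- grid R b k].
  by apply: (@allpairs_f _ _ _ pair); [exact: y1g|exact: y2g].
by split; apply: (@allpairs_f _ _ _ pair _ _ _ _ yk); rewrite !inE eqxx ?orbT.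
Qed.

Lemma curve_fourier_vanishes : vanishes_at_infinity (fourier (pushforward mu Gamma)).
Proof.
have [K K0 hK] := cascade_sum1_bounded X_ge0 X_cvg.
have [C [n0 [C0 hC]]] := curve_oscillation Gamma_curve.
have [G G0 hG] := curve_bounded Gamma_curve.
pose T := fine (mu setT).
have T0 : 0 <= T by rewrite fine_ge0.
(* The cosine and sine integrals will each be at most 2 [e1], so the total 4 e / 5 is strictly below
   e. *)
move=> e e0; pose e1 := e / 5; have e10 : 0 < e1 by rewrite divr_gt0.
have [n1 hn1] := X_bound hK e10.
pose D := C * K + 2 * G * T.
have [N hN] := exists_expr_ge (D / e1) (ltr1n R 2).
pose N0 := maxn n0 (maxn n1 N).
(* One factor 2 compares the Euclidean and sup norms; the other leaves room for the grid point y,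
   within distance 1 of z, to satisfy 64^n <= [sup_norm y]. *)
exists (4 * 64 ^+ N0) => xi hxi.
pose z := (2 * pi * xi.1, 2 * pi * xi.2).
have S2 : 2 * 64 ^+ N0 < sup_norm z.
  have h := euclidean_norm_le xi.
  have : sup_norm xi <= sup_norm z.
    have hp : 1 <= 2 * pi :> R by have := pi_ge2 R; lra.
    rewrite /z /sup_norm /= !normrM -normrM !(ger0_norm (x := 2 * pi)) ?(le_trans _ hp)//.
    rewrite ge_max !le_max; apply/andP; split; apply/orP; [left|right];
      by rewrite -[X in X <= _]mul1r ler_wpM2r.
  by lra.
have S1 : 64 ^+ N0 <= sup_norm z / 2 by lra.
have q64 : 1 < 64 :> R by rewrite ltr1n.
have [n /andP[nS Sn]] := exists_expr_lt q64 (le_trans (exprn_ege1 N0 (ltW q64)) S1).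
have N0n : (N0 <= n)%N by rewrite -ltnS -(ltr_eXn2l q64) (le_lt_trans S1).
have [n0n n1n Nn] : [/\ (n0 <= n)%N, (n1 <= n)%N & (N <= n)%N].
  by move: N0n; rewrite !geq_max => /andP[-> /andP[-> ->]].
have p1 : 1 <= 2 ^+ n :> R by rewrite exprn_ege1// ler1n.
have p0 : 0 < 2 ^+ n :> R by rewrite exprn_gt0.
have i1 : 2 ^- n <= 1 :> R by rewrite invf_le1.
have i0 : 0 <= 2 ^- n :> R by rewrite invr_ge0 ltW.
have [|y [zy1 zy2 yJ]] := @frequency_approx n z; first by lra.
have yS : 64 ^+ n <= sup_norm y.
  have h1 : 1 <= 64 ^+ n :> R by rewrite exprn_ege1// ltW.
  have h2 : sup_norm z <= sup_norm y + 1.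
    have y1 : `|y.1| <= sup_norm y by rewrite /sup_norm le_max lexx.
    have y2 : `|y.2| <= sup_norm y by rewrite /sup_norm le_max lexx orbT.
    apply: sup_norm_le.
    - rewrite -(subrK y.1 z.1) (le_trans (ler_normD _ _))//; lra.
    - rewrite -(subrK y.2 z.2) (le_trans (ler_normD _ _))//; lra.
  by lra.
have key th : (forall k, (n <= k)%N -> (y, th) \in frequencies b k) ->
    `|\int[mu]_x phase Gamma z th x| <= 2 * e1.
  move=> yth.
  apply: le_trans (phase_integral_dist Gamma_curve mu th zy1 zy2 hG) _.
  have : `|\int[mu]_x phase Gamma y th x| <= C / 2 ^+ n * K + e1.
    have hs := cascade_sum_cvg X_ge0 X_cvg
      (@continuous_phase _ _ Gamma_curve y th) (phase_le1 Gamma y th).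
    apply: (cvg_norm_le_frequently hs).
    by apply: (hn1 n n1n (y, th) _ yth) => u un; exact: hC.
  have : D / 2 ^+ n <= e1.
    rewrite ler_pdivrMr// -ler_pdivrMl// mulrC (le_trans hN)//.
    by rewrite ler_eXn2l ?ltr1n.
  rewrite -/T /D mulrDl.
  have -> : 2 / 2 ^+ n * G * T = 2 * G * T / 2 ^+ n by ring.
  have -> : C / 2 ^+ n * K = C * K / 2 ^+ n by ring.
  by lra.
rewrite fourier_pushforward//; apply: le_lt_trans (normc_le _ _) _.
rewrite normrN -/z.
have := key 0 (fun k nk => (yJ k nk).1).
have := key (- (pi / 2)) (fun k nk => (yJ k nk).2).
by rewrite /e1; lra.
Qed.

End phase_family.

(** * Logarithmic moments and the choice of q *)

Section log_moment.
Context (R : realType).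

Lemma log2_pos_ge0 (x : R) : 0 <= log2_pos x.
Proof. by rewrite /log2_pos le_max lexx orbT. Qed.

(** The negative part is bounded: 1 / x >= 1 - ln x gives x ln x >= x - 1 >= -1. *)
Lemma norm_mul_log2 (x : R) : 0 <= x -> `|x * log2 x| <= (ln 2)^-1 + x * log2_pos x.
Proof.
move=> x0; have l2 : 0 < ln 2 :> R by rewrite ln_gt0// ltr1n.
have l2V : 0 < (ln 2)^-1 :> R by rewrite invr_gt0.
have h0 := mulr_ge0 x0 (log2_pos_ge0 x).
have hle : x * log2 x <= x * log2_pos x by rewrite ler_wpM2l// /log2_pos le_max lexx.
rewrite ler_norml; apply/andP; split; last by lra.
suff : - (ln 2)^-1 <= x * log2 x by lra.
rewrite /log2 mulrA -[X in X <= _]mulN1r; apply: ler_wpM2r; first exact: ltW.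
have [->|xn0] := eqVneq x 0; first by rewrite mul0r lerN10.
have xp : 0 < x by rewrite lt_neqAle eq_sym xn0.
have := expR_ge1Dx (- ln x); rewrite expRN lnK ?posrE//.
move=> /(ler_wpM2l x0); rewrite mulfV// mulrDr mulr1 mulrN; lra.
Qed.

Lemma measurable_log2 : measurable_fun setT (@log2 R).
Proof. by apply: measurable_funM => //; exact: measurable_ln. Qed.

Lemma measurable_log2_pos : measurable_fun setT (@log2_pos R).
Proof. by apply: measurable_maxr => //; exact: measurable_log2. Qed.

Lemma integrable_mul_log2 d (T : measurableType d) (P : probability T R) (V : T -> R) :
  measurable_fun setT V -> (forall t, 0 <= V t) ->
  (\int[P]_t (V t * log2_pos (V t))%:E < +oo)%E ->
  P.-integrable setT (fun t => (V t * log2 (V t))%:E).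
Proof.
move=> mV V0 Vlog.
have mVl : measurable_fun setT (fun t => V t * log2_pos (V t)).
  by apply: measurable_funM => //; exact: (measurableT_comp measurable_log2_pos mV).
apply: (integrable_dominated (f := fun t => V t * log2 (V t))
  (g := fun t => (ln 2)^-1 + V t * log2_pos (V t))).
- by apply: measurable_funM => //; exact: (measurableT_comp measurable_log2 mV).
- by move=> t; exact: norm_mul_log2.
have iVl : P.-integrable setT (EFin \o fun t => V t * log2_pos (V t)).
  apply/integrableP; split; first exact/measurable_EFinP.
  by under eq_integral => t _ do rewrite /= ger0_norm ?mulr_ge0 ?log2_pos_ge0//.
exact: (integrableD measurableT (finite_measure_integrable_cst P (ln 2)^-1 measurableT) iVl).
Qed.

Variable rho : probability R R.
Hypotheses (rho_mean : (\int[rho]_y (pos_part y)%:E = 1)%E)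
  (rho_log_pos : (\int[rho]_y (pos_part y * log2_pos (pos_part y))%:E < +oo)%E)
  (rho_log : (\int[rho]_y (pos_part y * log2 (pos_part y))%:E < 1)%E).

Lemma pos_part_integrable : rho.-integrable setT (EFin \o @pos_part R).
Proof.
apply/integrableP; split; first by apply/measurable_EFinP; exact: measurable_pos_part.
under eq_integral => t _ do rewrite /= ger0_norm ?pos_part_ge0//.
by rewrite rho_mean ltry.
Qed.

Lemma Rintegral_pos_part : \int[rho]_y pos_part y = 1.
Proof. by rewrite /Rintegral rho_mean. Qed.

(** With h = E[W log2 W] and 2 beta = 2 / q^4, the biased drift is (h - 1) ln 2 + 4 ln q. The chosen
    q spends half of the gap: 4 ln q = (1 - h) ln 2 / 2, leaving the drift - (1 - h) ln 2 / 2. *)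
Lemma negative_drift : exists2 q : R, 1 < q &
  rho.-integrable setT (EFin \o (@pos_part R \* (fun y => ln (pos_part y / (2 / q ^+ 4))))) /\
  \int[rho]_y (pos_part y * ln (pos_part y / (2 / q ^+ 4))) < 0.
Proof.
have l2 : 0 < ln 2 :> R by rewrite ln_gt0// ltr1n.
have ilog := integrable_mul_log2 (@measurable_pos_part R) (@pos_part_ge0 R) rho_log_pos.
pose h := \int[rho]_y (pos_part y * log2 (pos_part y)).
have hE : (\int[rho]_y (pos_part y * log2 (pos_part y))%:E = h%:E)%E.
  by rewrite /h /Rintegral fineK//; exact: integrable_fin_num ilog.
have h1 : h < 1 by rewrite -lte_fin -hE.
pose q := expR ((1 - h) * ln 2 / 8).
have q1 : 1 < q by rewrite expR_gt1 divr_gt0// mulr_gt0// subr_gt0.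
exists q => //.
pose c := (1 + h) / 2 * ln 2.
have lE y : pos_part y * ln (pos_part y / (2 / q ^+ 4)) =
    ln 2 * (pos_part y * log2 (pos_part y)) - c * pos_part y.
  have [->|yn0] := eqVneq (pos_part y) 0; first by ring.
  have yp : 0 < pos_part y by rewrite lt_neqAle eq_sym yn0 pos_part_ge0.
  have q0 : 0 < q by exact: expR_gt0.
  rewrite !ln_div ?posrE ?divr_gt0 ?exprn_gt0// lnXn// /q expRK /log2 /c.
  by field; rewrite gt_eqF.
have i1 : rho.-integrable setT (EFin \o (fun y => ln 2 * (pos_part y * log2 (pos_part y)))).
  exact: (integrableZl measurableT (ln 2) ilog).
have i2 : rho.-integrable setT (EFin \o (fun y => c * pos_part y)).
  exact: (integrableZl measurableT c pos_part_integrable).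
split.
  apply: eq_integrable (integrableB measurableT i1 i2) => // y _.
  by rewrite /= lE.
under eq_Rintegral do rewrite lE.
rewrite RintegralB// RintegralZl// RintegralZl//; last exact: pos_part_integrable.
rewrite -/h Rintegral_pos_part mulr1 /c; nra.
Qed.

End log_moment.

(** * Almost sure nonnegativity of the weights *)

Section cascade_positive.
Context (R : realType) d0 (T0 : measurableType d0) (P0 : probability T0 R)
  (W : {RV P0 >-> R}) d (Omega : measurableType d) (P : probability Omega R)
  (Wu : seq bool -> {RV P >-> R}).
Hypotheses (W_ge0 : {ae P0, forall w, 0 <= W w}) (Wu_iid : iid_copies W Wu).

Lemma iid_copies_ge0 : {ae P, forall w, forall u, nonempty_words u -> 0 <= Wu u w}.
Proof.
have neg u : nonempty_words u -> P (Wu u @^-1` `]-oo, 0[) = 0.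
  move=> /(proj2 Wu_iid) /(_ `]-oo, 0[%classic (measurable_itv _)).
  rewrite /distribution /pushforward => ->.
  apply/negligibleP.
    by rewrite -[X in measurable X]setTI; exact: measurable_funP.
  apply: negligibleS W_ge0 => t /=; rewrite in_itv/= => Wt.
  by apply/negP; rewrite -ltNge.
(* Words are countable: enumerating them by their codes turns the statement into a countable
   intersection of almost sure events. *)
pose E n w := forall u, choice.unpickle n = Some u -> nonempty_words u -> 0 <= Wu u w.
have : {ae P, forall w n, E n w}.
  apply: ae_foralln => n; rewrite /E.
  case: (choice.unpickle n) => [v|]; last exact: aeW.
  suff : {ae P, forall w, nonempty_words v -> 0 <= Wu v w}.
    by apply: filterS => w hw u [<-].
  move: v => u.
  have [u0|nu] := pselect (nonempty_words u); last by apply: aeW => w /nu.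
  apply: (@negligibleS _ _ _ _ (Wu u @^-1` `]-oo, 0[%classic)).
    move=> w /= /not_implyP[_ /negP]; rewrite -ltNge in_itv/=.
    by [].
  apply/negligibleP; last exact: neg.
  by rewrite -[X in measurable X]setTI; exact: measurable_funP.
by apply: filterS => w hw u; apply: (hw (choice.pickle u)); rewrite choice.pickleK.
Qed.

Lemma expectation_pos_part (f : R -> R) : measurable_fun setT f ->
  ('E_P0[f \o W] = \int[P0]_t (f (pos_part (W t)))%:E)%E.
Proof.
move=> mf; rewrite unlock; apply: ae_eq_integral => //.
- by apply/measurable_EFinP; apply: measurableT_comp.
- apply/measurable_EFinP; apply: (measurableT_comp mf).
  exact: (measurableT_comp (@measurable_pos_part R)).
apply: filterS W_ge0 => t Wt _ /=.
by rewrite /pos_part max_l.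
Qed.

End cascade_positive.
Theorem theorem1p6 (R : realType)
  (d0 : measure_display) (T0 : measurableType d0) (P0 : probability T0 R)
  (W : {RV P0 >-> R})
  (W_ge0 : {ae P0, forall w, 0 <= W w})
  (W_mean1 : ('E_P0[W] = 1)%E)
  (W_log2_pos : ('E_P0[fun w => (W w * log2_pos (W w))%R] < +oo)%E)
  (W_log2 : ('E_P0[fun w => (W w * log2 (W w))%R] < 1)%E)
  (d : measure_display) (Omega : measurableType d) (P : probability Omega R)
  (Wu : seq bool -> {RV P >-> R})
  (Wu_iid : iid_copies W Wu)
  (mu : Omega -> {finite_measure set (circle R) -> \bar R})
  (mu_cascade : is_dyadic_cascade Wu mu)
  (Gamma : circle R -> R * R)
  (Gamma_curve : nondegenerate_C2_Jordan_curve Gamma) :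
  {ae P, forall w, (0 < mu w [set: circle R])%E ->
     vanishes_at_infinity (fourier (pushforward (mu w) Gamma))}.

Proof.
pose rho : probability R R := distribution P0 W.
have mp : measurable_fun setT (@pos_part R) := @measurable_pos_part R.
have mean : (\int[rho]_y (pos_part y)%:E = 1)%E.
  rewrite ge0_integral_distribution//; last 2 first.
  - exact/measurable_EFinP.
  - by move=> y; rewrite lee_fin pos_part_ge0.
  rewrite -W_mean1; apply/esym.
  exact: (expectation_pos_part W_ge0 (f := id)).
have mlp : measurable_fun setT (fun y : R => y * log2_pos y).
  by apply: measurable_funM => //; exact: measurable_log2_pos.
have ml : measurable_fun setT (fun y : R => y * log2 y).
  by apply: measurable_funM => //; exact: measurable_log2.
have WlogP : (\int[P0]_t (pos_part (W t) * log2_pos (pos_part (W t)))%:E < +oo)%E.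
  by rewrite -(expectation_pos_part W_ge0 mlp).
have log_pos : (\int[rho]_y (pos_part y * log2_pos (pos_part y))%:E < +oo)%E.
  rewrite ge0_integral_distribution//.
  - by apply/measurable_EFinP; exact: (measurableT_comp mlp mp).
  - by move=> y; rewrite lee_fin mulr_ge0 ?pos_part_ge0 ?log2_pos_ge0.
have log_lt : (\int[rho]_y (pos_part y * log2 (pos_part y))%:E < 1)%E.
  rewrite integral_distribution//.
  - by rewrite -(expectation_pos_part W_ge0 ml) in W_log2 *.
  - by apply/measurable_EFinP; exact: (measurableT_comp ml mp).
  - apply: integrable_mul_log2 WlogP; last by move=> t; exact: pos_part_ge0.
    exact: (measurableT_comp mp).
have [q q1 [iwl drift]] := negative_drift mean log_pos log_lt.
have ipos := pos_part_integrable mean.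
have pos1 := Rintegral_pos_part mean.
(* Since 2 / q^4 is 2 beta, the survival function of the walk with these steps, under [rho] biased
   by [pos_part], satisfies the equation required of [H]. *)
pose l (y : R) := ln (pos_part y / (2 / q ^+ 4)).
have mlq : measurable_fun setT l.
  apply: (measurableT_comp (@measurable_ln R)); exact: measurable_funM.
have p0 := @pos_part_ge0 R.
(* The base 512 = 8 * 64 is the one required by [frequency_approx]; the two coordinates of a
   frequency give at most a constant times (512 * 512)^k indices at level k. *)
have main := cascade_limit_bound (proj1 Wu_iid) (rho := rho)
  (fun u u0 B mB => proj2 Wu_iid u u0 B mB) q1
  (survival_ge0 p0 mp mlq ipos pos1) (survival_le1 p0 mp mlq ipos pos1)
  (@survival_lt0 _ _ _ rho (@pos_part R) l) (survival_nd p0 mp mlq ipos pos1)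
  (@survival_to1 _ _ _ rho _ l p0 mp mlq ipos pos1 iwl drift) ipos pos1
  (@survival_harmonic _ _ _ rho _ l p0 mp mlq ipos pos1)
  (Phi := phase_average Gamma) (J := frequencies R 512)
  (phase_average_harmonic Gamma_curve) (phase_average_le1 Gamma_curve)
  (isT : 0 < 512 * 512)%N (fun k => size_frequencies R k (isT : (0 < 512)%N)).
have pos := iid_copies_ge0 W_ge0 Wu_iid.
apply: filterS3 main pos mu_cascade => w bound w0 wcvg _.
apply: (curve_fourier_vanishes Gamma_curve w0 wcvg (isT : (1 < 512)%N) _ bound).
by rewrite -natrM ler_nat.
Qed.
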